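(* Let $X$ be a Banach space, $\varphi:X\to\,]-\infty,+\infty]$ be a proper lower semicontinuous function, and $\alpha>0$. Consider: (a) $\varphi$ is $\alpha$-robustly quasiconvex; (b) for all $x,y\in X$ with $\varphi(y)\le\varphi(x)$, one has $$\langle x^*,y-x\rangle\le-\min\{\alpha\|y-x\|,\ \varphi(x)-\varphi(y)\}\quad\text{for all }x^*\in\widehat\partial\varphi(x).$$ Then (a) implies (b). If in addition $X$ is an Asplund space, then (b) implies (a).
   Context: A function $f$ is quasiconvex if $f(\lambda x+(1-\lambda)y)\le\max\{f(x),f(y)\}$ for all $x,y\in X$, $\lambda\in\,]0,1[$. For $v^*\in X^*$, $\varphi_{v^*}(x):=\varphi(x)+\langle v^*,x\rangle$. $\varphi$ is $\alpha$-robustly quasiconvex if $\varphi_{v^*}$ is quasiconvex for every $v^*\in X^*$ with $\|v^*\|\le\alpha$. For $x\in\operatorname{dom}\varphi=\{x:\varphi(x)<\infty\}$, the Fréchet subdifferential is $\widehat\partial\varphi(x)=\{x^*\in X^*:\ \liminf_{y\to x}\frac{\varphi(y)-\varphi(x)-\langle x^*,y-x\rangle}{\|y-x\|}\ge 0\}$, and $\widehat\partial\varphi(x)=\emptyset$ otherwise. An Asplund space is a Banach space every separable subspace of which has separable dual. *)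

(* Defs.v *)
From Stdlib Require Import Reals Lra.
Open Scope R_scope.

Record NormedSpace := {
  V :> Type;
  vzero : V;
  vadd : V -> V -> V;
  vopp : V -> V;
  vscal : R -> V -> V;
  vnorm : V -> R;
  vadd_assoc : forall x y z, vadd x (vadd y z) = vadd (vadd x y) z;
  vadd_comm : forall x y, vadd x y = vadd y x;
  vadd_zero : forall x, vadd x vzero = x;
  vadd_opp : forall x, vadd x (vopp x) = vzero;
  vscal_one : forall x, vscal 1 x = x;
  vscal_assoc : forall a b x, vscal a (vscal b x) = vscal (a * b) x;
  vscal_distr_l : forall a x y, vscal a (vadd x y) = vadd (vscal a x) (vscal a y);
  vscal_distr_r : forall a b x, vscal (a + b) x = vadd (vscal a x) (vscal b x);
  vnorm_eq0 : forall x, vnorm x = 0 -> x = vzero;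
  vnorm_scal : forall a x, vnorm (vscal a x) = Rabs a * vnorm x;
  vnorm_triangle : forall x y, vnorm (vadd x y) <= vnorm x + vnorm y
}.

Arguments vzero {_}.
Arguments vadd {_} _ _.
Arguments vopp {_} _.
Arguments vscal {_} _ _.
Arguments vnorm {_} _.

Definition vsub {X : NormedSpace} (x y : X) : X := vadd x (vopp y).

Definition Banach (X : NormedSpace) : Prop :=
  forall u : nat -> X,
    (forall eps, 0 < eps -> exists N, forall m n, (N <= m)%nat -> (N <= n)%nat ->
        vnorm (vsub (u m) (u n)) < eps) ->
    exists l : X, forall eps, 0 < eps -> exists N, forall n, (N <= n)%nat ->
        vnorm (vsub (u n) l) < eps.

Definition is_dual {X : NormedSpace} (f : X -> R) : Prop :=
  (forall x y, f (vadd x y) = f x + f y) /\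
  (forall a x, f (vscal a x) = a * f x) /\
  (exists M, forall x, Rabs (f x) <= M * vnorm x).

Definition dual_norm_le {X : NormedSpace} (f : X -> R) (a : R) : Prop :=
  forall x, Rabs (f x) <= a * vnorm x.

Inductive ER := Fin (r : R) | PInf.

Definition ER_le (a b : ER) : Prop :=
  match a, b with
  | Fin x, Fin y => x <= y
  | _, PInf => True
  | PInf, Fin _ => False
  end.

Definition ER_max (a b : ER) : ER :=
  match a, b with
  | Fin x, Fin y => Fin (Rmax x y)
  | _, _ => PInf
  end.

Definition ER_addR (a : ER) (r : R) : ER :=
  match a with Fin x => Fin (x + r) | PInf => PInf end.

Definition in_dom {X : NormedSpace} (phi : X -> ER) (x : X) : Prop :=
  exists r, phi x = Fin r.

Definition proper {X : NormedSpace} (phi : X -> ER) : Prop :=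
  exists x, in_dom phi x.

Definition R_lt_ER (r : R) (e : ER) : Prop :=
  match e with Fin y => r < y | PInf => True end.

Definition lsc {X : NormedSpace} (phi : X -> ER) : Prop :=
  forall x r, R_lt_ER r (phi x) ->
    exists delta, 0 < delta /\
      forall y, vnorm (vsub y x) < delta -> R_lt_ER r (phi y).

Definition quasiconvex {X : NormedSpace} (f : X -> ER) : Prop :=
  forall x y lam, 0 < lam < 1 ->
    ER_le (f (vadd (vscal lam x) (vscal (1 - lam) y))) (ER_max (f x) (f y)).

Definition tilt {X : NormedSpace} (phi : X -> ER) (v : X -> R) : X -> ER :=
  fun x => ER_addR (phi x) (v x).

Definition robustly_quasiconvex {X : NormedSpace} (alpha : R) (phi : X -> ER) : Prop :=
  forall v : X -> R, is_dual v -> dual_norm_le v alpha -> quasiconvex (tilt phi v).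

Definition frechet_subdiff {X : NormedSpace} (phi : X -> ER) (x : X) (xs : X -> R) : Prop :=
  is_dual xs /\
  exists fx, phi x = Fin fx /\
  forall eps, 0 < eps -> exists delta, 0 < delta /\
    forall y, 0 < vnorm (vsub y x) < delta ->
      match phi y with
      | PInf => True
      | Fin fy => - eps <= (fy - fx - xs (vsub y x)) / vnorm (vsub y x)
      end.

Definition condition_b {X : NormedSpace} (alpha : R) (phi : X -> ER) : Prop :=
  forall (x y : X) (fx fy : R), phi x = Fin fx -> phi y = Fin fy -> fy <= fx ->
    forall xs, frechet_subdiff phi x xs ->
      xs (vsub y x) <= - Rmin (alpha * vnorm (vsub y x)) (fx - fy).

Definition is_subspace {X : NormedSpace} (S : X -> Prop) : Prop :=
  S vzero /\ (forall x y, S x -> S y -> S (vadd x y)) /\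
  (forall a x, S x -> S (vscal a x)).

Definition separable_subspace {X : NormedSpace} (S : X -> Prop) : Prop :=
  exists d : nat -> X, (forall n, S (d n)) /\
    forall x eps, S x -> 0 < eps -> exists n, vnorm (vsub (d n) x) < eps.

(** Continuous linear functionals on the subspace S (represented by functions
    X -> R, only their values on S matter). *)
Definition is_dual_on {X : NormedSpace} (S : X -> Prop) (g : X -> R) : Prop :=
  (forall x y, S x -> S y -> g (vadd x y) = g x + g y) /\
  (forall a x, S x -> g (vscal a x) = a * g x) /\
  (exists M, forall x, S x -> Rabs (g x) <= M * vnorm x).

Definition separable_dual {X : NormedSpace} (S : X -> Prop) : Prop :=
  exists gs : nat -> X -> R, (forall n, is_dual_on S (gs n)) /\
    forall g eps, is_dual_on S g -> 0 < eps ->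
      exists n, forall x, S x -> Rabs (g x - gs n x) <= eps * vnorm x.

Definition Asplund (X : NormedSpace) : Prop :=
  Banach X /\
  forall S : X -> Prop, is_subspace S -> separable_subspace S -> separable_dual S.

(* Main.v *)
(* Necessity: Hahn-Banach provides [v] with [|v| <= alpha] and
   [<v, y - x> = min (alpha |y - x|) (phi x - phi y)]; quasiconvexity of [phi + v] on [x, y]
   then bounds the difference quotients of [phi] at [x].

   Sufficiency rests on a mean value theorem for Frechet subgradients in Asplund spaces: if
   [f a < f b], then near [a, b] some [u] has a subgradient that is positive on [d - u], for any
   prescribed [d] on the ray from [a] beyond [b].  In a space with separable dual, squared dual
   distances to a dense sequence form a penalty on the dual ball whose conjugate is convex and
   Frechet smooth; this gives a smooth gauge, a smooth variational principle and hence
   the mean value theorem.  It passes to nonseparable spaces by separable reduction: failure of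
   the subgradient inequalities in the whole space is witnessed by finitely many points, and a
   separable subspace can be closed under choosing such witnesses.

   Applied to [phi], the theorem shows that (b) makes [phi] quasiconvex.  If a tilt [phi + v]
   were not quasiconvex, then [phi] would be nondecreasing on the part of the segment where
   [v] decreases, so [phi + v] would cross an intermediate level there without jumping
   down; the theorem, applied between the crossing point and the peak, contradicts (b). *)
From Stdlib Require Import Reals ZArith Lra Lia List Classical ClassicalEpsilon.
From Coquelicot Require Import Coquelicot.
From mathcomp Require boolp classical_sets.
From mathcomp Require Import choice.
Require Import Defs.
Open Scope R_scope.

(** * Linear identities and norms *)

(* The obstacle in the sufficiency proof is that (b) constrains a subgradient at [u] only towards
   points where [phi] is not larger than at [u], whereas an argument about [phi + v] naturally
   controls the values of [phi + v]. A useful [u] must dominate the comparison point for both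
   functions. Quasiconvexity of [phi] secures the first comparison, the crossing level the second,
   and lower semicontinuity extends both from the segment to a tube around it. The minimum in (b)
   then absorbs [v], whichever of its two terms is the smaller. In the mean value theorem the target
   lies strictly beyond [b]: this leaves a margin that pays for the distance from [u] to the segment
   and for the perturbation added by the variational principle. Functionals are produced by one form
   of Hahn-Banach: the constraints form a convex cone, and only their consistency at the origin has
   to be checked. In the separable reduction this form makes the absence of a subgradient equivalent
   to a finite linear certificate with a strict gap. The gap leaves room to move the base point to a
   dense point and to round all real parameters, so countably many certificates suffice. *)
Declare Scope vec_scope.
Notation "x +' y" := (vadd x y) (at level 50, left associativity) : vec_scope.
Notation "x -' y" := (vsub x y) (at level 50, left associativity) : vec_scope.
Notation "-' x" := (vopp x) (at level 35, right associativity) : vec_scope.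
Notation "a *' x" := (vscal a x) (at level 40, no associativity) : vec_scope.
Open Scope vec_scope.

(** Reflected syntax for the tactic [vec], which reduces an identity between linear combinations to
    one real identity per atom; coefficient goals that resist [ring] and [lra] are left to the
    caller. *)
Inductive vexp :=
| VAtom (n : nat) | VZero | VAdd (e f : vexp) | VSub (e f : vexp)
| VOpp (e : vexp) | VScal (r : R) (e : vexp).

Fixpoint veval {X : NormedSpace} (env : list X) (e : vexp) : X :=
  match e with
  | VAtom n => nth n env vzero
  | VZero => vzero
  | VAdd e f => veval env e +' veval env f
  | VSub e f => veval env e -' veval env f
  | VOpp e => -' veval env e
  | VScal r e => r *' veval env e
  end.

Fixpoint vcoef (e : vexp) (n : nat) : R :=
  match e with
  | VAtom m => if Nat.eqb m n then 1 else 0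
  | VZero => 0
  | VAdd e f => vcoef e n + vcoef f n
  | VSub e f => vcoef e n - vcoef f n
  | VOpp e => - vcoef e n
  | VScal r e => r * vcoef e n
  end.

Fixpoint vcomb {X : NormedSpace} (c : nat -> R) (l : list X) : X :=
  match l with
  | nil => vzero
  | x :: l' => c O *' x +' vcomb (fun n => c (S n)) l'
  end.

Fixpoint vcoef_eq (N : nat) (e f : vexp) : Prop :=
  match N with
  | O => True
  | S N' => vcoef e N' = vcoef f N' /\ vcoef_eq N' e f
  end.

Section VectorNormalForm.
Context {X : NormedSpace}.
Implicit Types (x y z : X) (l : list X).

Lemma vzero_add x : vzero +' x = x.
Proof. rewrite vadd_comm; apply vadd_zero. Qed.

Lemma vadd_cancel x y z : x +' z = y +' z -> x = y.
Proof.
  intros H.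
  rewrite <- (vadd_zero _ x), <- (vadd_zero _ y), <- (vadd_opp _ z).
  rewrite !vadd_assoc, H; reflexivity.
Qed.

Lemma vscal_zero_l x : 0 *' x = vzero.
Proof.
  apply (vadd_cancel _ _ (0 *' x)).
  rewrite <- vscal_distr_r, vzero_add; f_equal; ring.
Qed.

Lemma vscal_zero_r a : a *' (vzero : X) = vzero.
Proof.
  apply (vadd_cancel _ _ (a *' vzero)).
  rewrite <- vscal_distr_l, !vzero_add; reflexivity.
Qed.

Lemma vopp_scal x : -' x = (-1) *' x.
Proof.
  apply (vadd_cancel _ _ x).
  rewrite (vadd_comm _ (-' x)), vadd_opp.
  rewrite <- (vscal_one _ x) at 2.
  rewrite <- vscal_distr_r, <- (vscal_zero_l x); f_equal; ring.
Qed.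

Lemma vadd_swap (a b c d : X) : (a +' b) +' (c +' d) = (a +' c) +' (b +' d).
Proof.
  rewrite <- (vadd_assoc _ a b), (vadd_assoc _ b c d), (vadd_comm _ b c).
  rewrite <- (vadd_assoc _ c b d), vadd_assoc; reflexivity.
Qed.

Lemma vcomb_add c1 c2 l :
  vcomb c1 l +' vcomb c2 l = vcomb (fun n => c1 n + c2 n) l.
Proof.
  revert c1 c2; induction l as [|x l IH]; intros; simpl.
  - apply vadd_zero.
  - rewrite vadd_swap, IH, vscal_distr_r; reflexivity.
Qed.

Lemma vcomb_scal a c l : a *' vcomb c l = vcomb (fun n => a * c n) l.
Proof.
  revert c; induction l as [|x l IH]; intros; simpl.
  - apply vscal_zero_r.
  - rewrite vscal_distr_l, IH, vscal_assoc; reflexivity.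
Qed.

Lemma vcomb_zero c l : (forall n, (n < length l)%nat -> c n = 0) -> vcomb c l = vzero.
Proof.
  revert c; induction l as [|x l IH]; intros c Hc; simpl; [reflexivity|].
  rewrite (Hc O), vscal_zero_l, vzero_add; [|simpl; lia].
  apply IH; intros n Hn; apply Hc; simpl; lia.
Qed.

Lemma vcomb_ext c1 c2 l :
  (forall n, (n < length l)%nat -> c1 n = c2 n) -> vcomb c1 l = vcomb c2 l.
Proof.
  revert c1 c2; induction l as [|x l IH]; intros c1 c2 Hc; simpl; [reflexivity|].
  rewrite (Hc O) by (simpl; lia).
  f_equal; apply IH; intros n Hn; apply Hc; simpl; lia.
Qed.

Lemma vcomb_atom m l :
  vcomb (fun n => if Nat.eqb m n then 1 else 0) l = nth m l vzero.
Proof.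
  revert m; induction l as [|x l IH]; intros [|m]; simpl; auto.
  - rewrite vscal_one, vcomb_zero, vadd_zero; auto.
  - rewrite vscal_zero_l, vzero_add; apply IH.
Qed.

Lemma veval_vcomb l e : veval l e = vcomb (vcoef e) l.
Proof.
  induction e as [n| |e IHe f IHf|e IHe f IHf|e IHe|r e IHe]; simpl.
  - symmetry; apply vcomb_atom.
  - symmetry; apply vcomb_zero; auto.
  - rewrite IHe, IHf, vcomb_add; reflexivity.
  - unfold vsub; rewrite IHe, IHf, vopp_scal, vcomb_scal, vcomb_add.
    apply vcomb_ext; intros; ring.
  - rewrite IHe, vopp_scal, vcomb_scal.
    apply vcomb_ext; intros; ring.
  - rewrite IHe, vcomb_scal; reflexivity.
Qed.

Lemma vcoef_eq_sound l e f : vcoef_eq (length l) e f -> veval l e = veval l f.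
Proof.
  intros H; rewrite !veval_vcomb; apply vcomb_ext.
  revert H; generalize (length l) as N; induction N as [|N IH]; simpl; intros H n Hn.
  - lia.
  - destruct (Nat.eq_dec n N) as [->|]; [tauto|].
    apply IH; [tauto|lia].
Qed.

End VectorNormalForm.

Ltac vmem x l :=
  lazymatch l with
  | nil => constr:(false)
  | x :: _ => constr:(true)
  | _ :: ?l' => vmem x l'
  end.
Ltac vindex x l :=
  lazymatch l with
  | x :: _ => constr:(O)
  | _ :: ?l' => let n := vindex x l' in constr:(S n)
  end.
Ltac vatoms e l :=
  lazymatch e with
  | vzero => l
  | vadd ?a ?b => let l' := vatoms a l in vatoms b l'
  | vsub ?a ?b => let l' := vatoms a l in vatoms b l'
  | vopp ?a => vatoms a l
  | vscal _ ?a => vatoms a l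
  | _ => lazymatch vmem e l with true => l | false => constr:(e :: l) end
  end.
Ltac vreify e l :=
  lazymatch e with
  | vzero => constr:(VZero)
  | vadd ?a ?b => let a' := vreify a l in let b' := vreify b l in constr:(VAdd a' b')
  | vsub ?a ?b => let a' := vreify a l in let b' := vreify b l in constr:(VSub a' b')
  | vopp ?a => let a' := vreify a l in constr:(VOpp a')
  | vscal ?r ?a => let a' := vreify a l in constr:(VScal r a')
  | _ => let n := vindex e l in constr:(VAtom n)
  end.
Ltac vec :=
  lazymatch goal with
  | |- @eq (V ?X) ?a ?b =>
      let l0 := vatoms a (@nil (V X)) in
      let l := vatoms b l0 in
      let ea := vreify a l in
      let eb := vreify b l in
      change (veval l ea = veval l eb);
      apply vcoef_eq_sound;
      cbn [vcoef_eq length vcoef Nat.eqb];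
      repeat split; try ring; try lra
  end.

Section NormFacts.
Context {X : NormedSpace}.
Implicit Types (x y z : X).

Lemma vnorm_vzero : vnorm (vzero : X) = 0.
Proof.
  rewrite <- (vscal_zero_l vzero), vnorm_scal, Rabs_R0; ring.
Qed.

Lemma vnorm_opp x : vnorm (-' x) = vnorm x.
Proof.
  rewrite vopp_scal, vnorm_scal, Rabs_left by lra; ring.
Qed.

Lemma vnorm_nonneg x : 0 <= vnorm x.
Proof.
  pose proof (vnorm_triangle X x (-' x)) as H.
  rewrite vadd_opp, vnorm_vzero, vnorm_opp in H; lra.
Qed.

Lemma vnorm_sub_sym x y : vnorm (x -' y) = vnorm (y -' x).
Proof.
  rewrite <- (vnorm_opp (x -' y)); f_equal; vec.
Qed.

Lemma vnorm_scal_nonneg a x : 0 <= a -> vnorm (a *' x) = a * vnorm x.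
Proof. intros; rewrite vnorm_scal, Rabs_pos_eq; auto. Qed.

Lemma vnorm_sub_triangle x y z : vnorm (x -' z) <= vnorm (x -' y) + vnorm (y -' z).
Proof.
  replace (x -' z) with ((x -' y) +' (y -' z)) by vec.
  apply vnorm_triangle.
Qed.

Lemma vnorm_sub_self x : vnorm (x -' x) = 0.
Proof.
  replace (x -' x) with (vzero : X) by vec; apply vnorm_vzero.
Qed.

Lemma vnorm_sub_le x y : vnorm (x -' y) <= vnorm x + vnorm y.
Proof.
  unfold vsub; rewrite <- (vnorm_opp y); apply vnorm_triangle.
Qed.

Lemma vnorm_le_sub x y : vnorm x <= vnorm y + vnorm (x -' y).
Proof.
  replace x with (y +' (x -' y)) at 1 by vec.
  apply vnorm_triangle.
Qed.

Lemma vsub_eq0 x y : vnorm (x -' y) = 0 -> x = y.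
Proof.
  intros H; apply vnorm_eq0 in H.
  replace x with (y +' (x -' y)) by vec.
  rewrite H; apply vadd_zero.
Qed.

End NormFacts.

Definition linear_form {X : NormedSpace} (f : X -> R) : Prop :=
  (forall x y, f (x +' y) = f x + f y) /\ (forall a x, f (a *' x) = a * f x).

Definition bounded_by {X : NormedSpace} (M : R) (f : X -> R) : Prop :=
  forall x, Rabs (f x) <= M * vnorm x.

Section LinearFacts.
Context {X : NormedSpace} (f : X -> R) (Hf : linear_form f).

Lemma linear_zero : f vzero = 0.
Proof. rewrite <- (vscal_zero_l vzero), (proj2 Hf); ring. Qed.

Lemma linear_opp x : f (-' x) = - f x.
Proof. rewrite vopp_scal, (proj2 Hf); ring. Qed.

Lemma linear_sub x y : f (x -' y) = f x - f y.
Proof. unfold vsub; rewrite (proj1 Hf), linear_opp; ring. Qed.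

Lemma linear_bounded_of_le M : (forall x, f x <= M * vnorm x) -> bounded_by M f.
Proof.
  intros H x; apply Rabs_le; split; [|apply H].
  pose proof (H (-' x)) as H1; rewrite linear_opp, vnorm_opp in H1; lra.
Qed.

End LinearFacts.

Lemma bounded_by_le {X : NormedSpace} (M : R) (f : X -> R) x :
  bounded_by M f -> - (M * vnorm x) <= f x <= M * vnorm x.
Proof. intros H; apply Rabs_le_between, H. Qed.

Lemma bounded_by_weaken {X : NormedSpace} (M M' : R) (f : X -> R) :
  M <= M' -> bounded_by M f -> bounded_by M' f.
Proof.
  intros HM H x; eapply Rle_trans; [apply H|].
  apply Rmult_le_compat_r; [apply vnorm_nonneg|exact HM].
Qed.

Lemma is_dual_iff {X : NormedSpace} (f : X -> R) :
  is_dual f <-> linear_form f /\ exists M, 0 <= M /\ bounded_by M f.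
Proof.
  split.
  - intros (H1 & H2 & M & HM); split; [split; auto|].
    exists (Rmax M 0); split; [apply Rmax_r|].
    apply (bounded_by_weaken M); [apply Rmax_l|exact HM].
  - intros ((H1 & H2) & M & _ & HM); split; [auto|split; auto].
    exists M; exact HM.
Qed.

(** * Hahn-Banach *)

(** [real] sends an infinite bound to 0, so the value has a meaning only for a nonempty set with a
    lower bound, as [Rinf_spec] requires. *)
Definition Rinf (E : R -> Prop) : R := real (Glb_Rbar E).

Lemma Rinf_spec (E : R -> Prop) (m : R) :
  (exists x, E x) -> (forall x, E x -> m <= x) ->
  (forall x, E x -> Rinf E <= x) /\ (forall m', (forall x, E x -> m' <= x) -> m' <= Rinf E).
Proof.
  intros [x0 Hx0] Hm; unfold Rinf.
  destruct (Glb_Rbar_correct E) as [H1 H2].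
  destruct (Glb_Rbar E) as [l| |]; simpl.
  - split; [exact H1|intros m' Hm'; apply (H2 (Finite m')); exact Hm'].
  - destruct (H1 x0 Hx0).
  - destruct (H2 (Finite m) Hm).
Qed.

Lemma Rinf_approx (E : R -> Prop) (m eps : R) :
  (exists x, E x) -> (forall x, E x -> m <= x) -> 0 < eps ->
  exists x, E x /\ x < Rinf E + eps.
Proof.
  intros HE Hm He; apply NNPP; intros Hn.
  destruct (Rinf_spec E m HE Hm) as [_ H2].
  assert (Rinf E + eps <= Rinf E); [|lra].
  apply H2; intros x Hx; apply Rnot_lt_le; intros Hlt; apply Hn; eauto.
Qed.

Definition sublinear {X : NormedSpace} (p : X -> R) : Prop :=
  (forall x y, p (x +' y) <= p x + p y) /\ (forall t x, 0 < t -> p (t *' x) = t * p x).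

Section HahnBanach.
Context {X : NormedSpace}.

Lemma sublinear_zero (p : X -> R) : sublinear p -> p vzero = 0.
Proof.
  intros [_ H]; pose proof (H 2 vzero ltac:(lra)) as H2.
  rewrite vscal_zero_r in H2; lra.
Qed.

Lemma sublinear_opp (p : X -> R) x : sublinear p -> - p (-' x) <= p x.
Proof.
  intros H; pose proof (proj1 H x (-' x)) as H1.
  rewrite vadd_opp, sublinear_zero in H1 by auto; lra.
Qed.

Lemma positive_homogeneous_of_le (p : X -> R) :
  (forall t x, 0 < t -> p (t *' x) <= t * p x) -> forall t x, 0 < t -> p (t *' x) = t * p x.
Proof.
  intros H t x Ht; apply Rle_antisym; [apply H; auto|].
  pose proof (H (/ t) (t *' x) (Rinv_0_lt_compat _ Ht)) as H1.
  rewrite vscal_assoc, Rinv_l, vscal_one in H1 by lra.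
  apply (Rmult_le_compat_l t) in H1; [|lra].
  rewrite <- Rmult_assoc, Rinv_r, Rmult_1_l in H1 by lra; exact H1.
Qed.

(** The witness is the pointwise infimum of the chain, finite because a sublinear [q] below [p0]
    satisfies [q x >= - p0 (-' x)]. Subadditivity uses comparability: of two members nearly optimal
    at [x] and at [y], the smaller one is nearly optimal at both. This supplies the bounds of chains
    in Zorn's lemma. *)
Lemma chain_inf_sublinear (p0 : X -> R) (A : (X -> R) -> Prop) :
  (exists q, A q) -> (forall q, A q -> sublinear q /\ forall x, q x <= p0 x) ->
  (forall q r, A q -> A r -> (forall x, r x <= q x) \/ (forall x, q x <= r x)) ->
  exists q0, sublinear q0 /\ (forall x, q0 x <= p0 x) /\ forall q, A q -> forall x, q0 x <= q x.
Proof.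
  intros [q1 Hq1] HA Hch.
  set (E := fun x s => exists q, A q /\ s = q x).
  assert (HE : forall x, exists s, E x s) by (intros x; exists (q1 x), q1; auto).
  assert (Hm : forall x s, E x s -> - p0 (-' x) <= s).
  { intros x s (q & Hq & ->); destruct (HA q Hq) as [Hs Hle].
    pose proof (sublinear_opp q x Hs); pose proof (Hle (-' x)); lra. }
  set (q0 := fun x => Rinf (E x)).
  assert (Hlow : forall q, A q -> forall x, q0 x <= q x).
  { intros q Hq x; apply (proj1 (Rinf_spec _ _ (HE x) (Hm x))); exists q; auto. }
  exists q0; repeat split; auto.
  - intros x y; apply le_epsilon; intros eps Heps.
    destruct (Rinf_approx _ _ (eps / 2) (HE x) (Hm x)) as (s & (q & Hq & ->) & Hs); [lra|].
    destruct (Rinf_approx _ _ (eps / 2) (HE y) (Hm y)) as (s & (r & Hr & ->) & Hs'); [lra|].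
    fold (q0 x) in Hs; fold (q0 y) in Hs'.
    destruct (Hch q r Hq Hr) as [H|H].
    + pose proof (Hlow r Hr (x +' y)); pose proof (proj1 (proj1 (HA r Hr)) x y).
      pose proof (H x); lra.
    + pose proof (Hlow q Hq (x +' y)); pose proof (proj1 (proj1 (HA q Hq)) x y).
      pose proof (H y); lra.
  - apply positive_homogeneous_of_le; intros t x Ht; apply le_epsilon; intros eps Heps.
    destruct (Rinf_approx _ _ (eps / t) (HE x) (Hm x)) as (s & (q & Hq & ->) & Hs);
      [apply Rdiv_lt_0_compat; auto|].
    fold (q0 x) in Hs.
    pose proof (Hlow q Hq (t *' x)) as H1; rewrite (proj2 (proj1 (HA q Hq))) in H1 by auto.
    apply (Rmult_lt_compat_l t) in Hs; auto.
    replace (t * (q0 x + eps / t)) with (t * q0 x + eps) in Hs by (field; lra); lra.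
  - intros x; eapply Rle_trans; [apply (Hlow q1 Hq1)|apply (HA q1 Hq1)].
Qed.

(* For each [z], the infimum of [q (x + t z) - t q z] over [t >= 0] is sublinear and below [q],
   so by minimality it equals [q], whence [q (- z) <= - q z]. *)
Lemma minimal_sublinear_linear (q : X -> R) :
  sublinear q -> (forall r, sublinear r -> (forall x, r x <= q x) -> forall x, q x <= r x) ->
  linear_form q.
Proof.
  intros Hq Hmin.
  assert (Hopp : forall z, q (-' z) <= - q z).
  { intros z.
    set (E := fun x s => exists t, 0 <= t /\ s = q (x +' t *' z) - t * q z).
    assert (HE : forall x, exists s, E x s) by (intros x; eexists; exists 0; split; [lra|reflexivity]).
    assert (Hhom : forall t x, 0 <= t -> q (t *' x) = t * q x).
    { intros t x [Ht| <-]; [apply Hq; auto|].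
      rewrite vscal_zero_l, sublinear_zero by auto; ring. }
    assert (Hm : forall x s, E x s -> - q (-' x) <= s).
    { intros x s (t & Ht & ->).
      pose proof (proj1 Hq (x +' t *' z) (-' x)) as H1.
      replace (x +' t *' z +' -' x) with (t *' z) in H1 by vec.
      rewrite Hhom in H1 by auto; lra. }
    set (r := fun x => Rinf (E x)).
    assert (Hlow : forall x t, 0 <= t -> r x <= q (x +' t *' z) - t * q z).
    { intros x t Ht; apply (proj1 (Rinf_spec _ _ (HE x) (Hm x))); exists t; auto. }
    assert (Hr : forall x, q x <= r x).
    { apply Hmin.
      - split.
        + intros x y; apply le_epsilon; intros eps Heps.
          destruct (Rinf_approx _ _ (eps / 2) (HE x) (Hm x)) as (s & (t & Ht & ->) & Hs); [lra|].
          destruct (Rinf_approx _ _ (eps / 2) (HE y) (Hm y)) as (s & (t' & Ht' & ->) & Hs'); [lra|].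
          fold (r x) in Hs; fold (r y) in Hs'.
          pose proof (Hlow (x +' y) (t + t') ltac:(lra)) as H1.
          replace (x +' y +' (t + t') *' z) with ((x +' t *' z) +' (y +' t' *' z)) in H1 by vec.
          pose proof (proj1 Hq (x +' t *' z) (y +' t' *' z)); lra.
        + apply positive_homogeneous_of_le; intros a x Ha; apply le_epsilon; intros eps Heps.
          destruct (Rinf_approx _ _ (eps / a) (HE x) (Hm x)) as (s & (t & Ht & ->) & Hs);
            [apply Rdiv_lt_0_compat; auto|].
          fold (r x) in Hs.
          pose proof (Hlow (a *' x) (a * t) ltac:(nra)) as H1.
          replace (a *' x +' (a * t) *' z) with (a *' (x +' t *' z)) in H1 by vec.
          rewrite (proj2 Hq) in H1 by auto.
          apply (Rmult_lt_compat_l a) in Hs; auto.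
          replace (a * (r x + eps / a)) with (a * r x + eps) in Hs by (field; lra); lra.
      - intros x; pose proof (Hlow x 0 ltac:(lra)) as H1.
        replace (x +' 0 *' z) with x in H1 by vec; lra. }
    pose proof (Hr (-' z)); pose proof (Hlow (-' z) 1 ltac:(lra)) as H1.
    replace (-' z +' 1 *' z) with (vzero : X) in H1 by vec.
    rewrite sublinear_zero in H1 by auto; lra. }
  assert (Hopp' : forall z, q (-' z) = - q z).
  { intros z; pose proof (Hopp z); pose proof (sublinear_opp q z Hq); lra. }
  split.
  - intros x y; apply Rle_antisym; [apply Hq|].
    pose proof (proj1 Hq (x +' y) (-' y)) as H.
    replace (x +' y +' -' y) with x in H by vec.
    rewrite Hopp' in H; lra.
  - intros a x; destruct (Rtotal_order a 0) as [Ha|[->|Ha]].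
    + replace (a *' x) with ((- a) *' (-' x)) by vec.
      rewrite (proj2 Hq), Hopp' by lra; ring.
    + rewrite vscal_zero_l, sublinear_zero by auto; ring.
    + apply Hq; auto.
Qed.

Lemma hahn_banach_sublinear (p : X -> R) :
  sublinear p -> exists f, linear_form f /\ forall x, f x <= p x.
Proof.
  intros Hp.
  pose (T := {q : X -> R | sublinear q /\ forall x, q x <= p x}).
  (* The order is reversed: an element maximal for [P] is a minimal sublinear function. *)
  pose (P := fun q r : T => forall x, proj1_sig r x <= proj1_sig q x).
  destruct (@classical_sets.ZL_preorder T (exist _ p (conj Hp (fun x => Rle_refl _)))
              (fun q r => boolp.asbool (P q r))) as [[q [Hq Hqp]] Hmin].
  - intros q; apply boolp.asboolT; intros x; apply Rle_refl.
  - intros q r s H1 H2; apply boolp.asboolW in H1; apply boolp.asboolW in H2.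
    apply boolp.asboolT; intros x; eapply Rle_trans; [apply H2|apply H1].
  - intros A HA.
    destruct (classic (exists q, A q)) as [[q1 Hq1]|Hn].
    + destruct (chain_inf_sublinear p (fun q => exists t : T, A t /\ proj1_sig t = q))
        as (q0 & Hq0 & Hle & Hlow).
      * exists (proj1_sig q1), q1; auto.
      * intros q (t & _ & <-); exact (proj2_sig t).
      * intros q r (t & Ht & <-) (t' & Ht' & <-).
        destruct (HA t t' Ht Ht') as [H|H]; apply boolp.asboolW in H; auto.
      * exists (exist _ q0 (conj Hq0 Hle)); intros s Hs; apply boolp.asboolT; intros x.
        apply Hlow; exists s; auto.
    + exists (exist _ p (conj Hp (fun x => Rle_refl _))); intros s Hs; destruct Hn; eauto.
  - exists q; split; auto.
    apply minimal_sublinear_linear; auto.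
    intros r Hr Hle.
    assert (Hrp : forall x, r x <= p x) by (intros x; eapply Rle_trans; [apply Hle|apply Hqp]).
    specialize (Hmin (exist _ r (conj Hr Hrp))).
    assert (H : is_true (boolp.asbool (P (exist _ r (conj Hr Hrp)) (exist _ q (conj Hq Hqp))))).
    { apply Hmin, boolp.asboolT; exact Hle. }
    apply boolp.asboolW in H; exact H.
Qed.

(* [Q h s] reads: the value at [h] of the functional sought is required to be at most [s]. *)
Lemma hahn_banach (Q : X -> R -> Prop) :
  (forall h1 h2 s1 s2, Q h1 s1 -> Q h2 s2 -> Q (h1 +' h2) (s1 + s2)) ->
  (forall t h s, 0 < t -> Q h s -> Q (t *' h) (t * s)) ->
  (forall h, exists s, Q h s) ->
  (forall s, Q vzero s -> 0 <= s) ->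
  exists f, linear_form f /\ forall h s, Q h s -> f h <= s.
Proof.
  intros Hadd Hscal Htot H0.
  assert (Hlow : forall h, exists m, forall s, Q h s -> m <= s).
  { intros h; destruct (Htot (-' h)) as [s' Hs'].
    exists (- s'); intros s Hs.
    pose proof (Hadd _ _ _ _ Hs Hs') as H; rewrite vadd_opp in H; apply H0 in H; lra. }
  set (p := fun h => Rinf (Q h)).
  assert (Hp : forall h s, Q h s -> p h <= s).
  { intros h s Hs; destruct (Hlow h) as [m Hm].
    apply (proj1 (Rinf_spec _ m (Htot h) Hm)); auto. }
  assert (Hap : forall h eps, 0 < eps -> exists s, Q h s /\ s < p h + eps).
  { intros h eps He; destruct (Hlow h) as [m Hm].
    apply (Rinf_approx _ m eps (Htot h) Hm He). }
  destruct (hahn_banach_sublinear p) as (f & Hf & Hfp).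
  - split.
    + intros x y; apply le_epsilon; intros eps Heps.
      destruct (Hap x (eps / 2)) as (s & Hs & Hs'); [lra|].
      destruct (Hap y (eps / 2)) as (s2 & Hs2 & Hs2'); [lra|].
      pose proof (Hp _ _ (Hadd _ _ _ _ Hs Hs2)); lra.
    + apply positive_homogeneous_of_le; intros t x Ht; apply le_epsilon; intros eps Heps.
      destruct (Hap x (eps / t)) as (s & Hs & Hs'); [apply Rdiv_lt_0_compat; auto|].
      pose proof (Hp _ _ (Hscal t _ _ Ht Hs)).
      apply (Rmult_lt_compat_l t) in Hs'; auto.
      replace (t * (p x + eps / t)) with (t * p x + eps) in Hs' by (field; lra); lra.
  - exists f; split; auto.
    intros h s Hs; eapply Rle_trans; [apply Hfp|apply Hp; auto].
Qed.

(** The constraints with [t = 0] give the bound [a]; the one with [t = 1] at [-' e] gives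
    [m <= f e]. At the origin they read [t * (a * vnorm e - m) >= 0], which is the hypothesis on
    [m]. *)
Lemma norming_functional (a m : R) (e : X) :
  0 <= a -> m <= a * vnorm e -> exists f, linear_form f /\ bounded_by a f /\ m <= f e.
Proof.
  intros Ha Hm.
  destruct (hahn_banach (fun h s => exists t, 0 <= t /\ a * vnorm (h +' t *' e) - t * m <= s))
    as (f & Hf & HQ).
  - intros h1 h2 s1 s2 (t1 & Ht1 & H1) (t2 & Ht2 & H2).
    exists (t1 + t2); split; [lra|].
    replace (h1 +' h2 +' (t1 + t2) *' e) with ((h1 +' t1 *' e) +' (h2 +' t2 *' e)) by vec.
    pose proof (vnorm_triangle X (h1 +' t1 *' e) (h2 +' t2 *' e)); nra.
  - intros t h s Ht (t1 & Ht1 & H1); exists (t * t1); split; [nra|].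
    replace (t *' h +' (t * t1) *' e) with (t *' (h +' t1 *' e)) by vec.
    rewrite vnorm_scal_nonneg by lra; nra.
  - intros h; eexists; exists 0; split; [lra|apply Rle_refl].
  - intros s (t & Ht & H); rewrite vzero_add, vnorm_scal_nonneg in H by auto; nra.
  - exists f; split; [auto|split].
    + apply linear_bounded_of_le; auto; intros x; apply HQ; exists 0; split; [lra|].
      replace (x +' 0 *' e) with x by vec; lra.
    + assert (Hn : f (-' e) <= - m); [|rewrite linear_opp in Hn by auto; lra].
      apply HQ; exists 1; split; [lra|].
      replace (-' e +' 1 *' e) with (vzero : X) by vec.
      rewrite vnorm_vzero; lra.
Qed.

End HahnBanach.

(** * Smooth convex functions *)

Definition wsum (a : nat -> R) : R := Series (fun n => a n * (1 / 2) ^ n).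

Definition bounded_seq (a : nat -> R) : Prop := exists M, forall n, Rabs (a n) <= M.

Fixpoint psum (a : nat -> R) (n : nat) : R :=
  match n with O => 0 | S n => psum a n + a n * (1 / 2) ^ n end.

Lemma half_pow_pos n : 0 < (1 / 2) ^ n.
Proof. apply pow_lt; lra. Qed.

Lemma half_pow_small eps : 0 < eps -> exists n, (1 / 2) ^ n < eps.
Proof.
  intros He; destruct (pow_lt_1_zero (1 / 2) ltac:(rewrite Rabs_pos_eq; lra) eps He) as [N HN].
  exists N; specialize (HN N (Nat.le_refl N)); rewrite Rabs_pos_eq in HN; auto.
  apply Rlt_le, half_pow_pos.
Qed.

Lemma ex_series_half_pow : ex_series (fun n => (1 / 2) ^ n).
Proof. apply ex_series_geom; rewrite Rabs_pos_eq; lra. Qed.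

Lemma wsum_ex a : bounded_seq a -> ex_series (fun n => a n * (1 / 2) ^ n).
Proof.
  intros [M HM]; apply (@ex_series_le R_AbsRing R_CompleteNormedModule _ (fun n => M * (1 / 2) ^ n)).
  - intros n; unfold norm; simpl; unfold abs; simpl.
    rewrite Rabs_mult, (Rabs_pos_eq ((1 / 2) ^ n)) by apply Rlt_le, half_pow_pos.
    apply Rmult_le_compat_r; [apply Rlt_le, half_pow_pos|apply HM].
  - apply (ex_series_scal_l (K := R_AbsRing) M (fun n => (1 / 2) ^ n)), ex_series_half_pow.
Qed.

Lemma wsum_ext a b : (forall n, a n = b n) -> wsum a = wsum b.
Proof. intros H; apply Series_ext; intros n; rewrite H; reflexivity. Qed.

Lemma wsum_plus a b : bounded_seq a -> bounded_seq b ->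
  wsum (fun n => a n + b n) = wsum a + wsum b.
Proof.
  intros Ha Hb; unfold wsum; rewrite <- Series_plus by (apply wsum_ex; auto).
  apply Series_ext; intros n; ring.
Qed.

Lemma wsum_scal c a : wsum (fun n => c * a n) = c * wsum a.
Proof.
  unfold wsum; rewrite <- Series_scal_l; apply Series_ext; intros n; ring.
Qed.

Lemma wsum_const M : wsum (fun _ => M) = 2 * M.
Proof.
  unfold wsum; rewrite (Series_scal_l M (fun n => (1 / 2) ^ n)), Series_geom.
  - field.
  - rewrite Rabs_pos_eq; lra.
Qed.

Lemma bounded_seq_const M : bounded_seq (fun _ => M).
Proof. exists (Rabs M); intros; lra. Qed.

Lemma bounded_seq_plus a b : bounded_seq a -> bounded_seq b -> bounded_seq (fun n => a n + b n).
Proof.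
  intros [M HM] [N HN]; exists (M + N); intros n.
  pose proof (Rabs_triang (a n) (b n)); pose proof (HM n); pose proof (HN n); lra.
Qed.

Lemma bounded_seq_scal c a : bounded_seq a -> bounded_seq (fun n => c * a n).
Proof.
  intros [M HM]; exists (Rabs c * M); intros n; rewrite Rabs_mult.
  apply Rmult_le_compat_l; [apply Rabs_pos|apply HM].
Qed.

Lemma bounded_seq_minus a b : bounded_seq a -> bounded_seq b -> bounded_seq (fun n => a n - b n).
Proof.
  intros [M HM] [N HN]; exists (M + N); intros n.
  pose proof (Rabs_triang (a n) (- b n)); rewrite Rabs_Ropp in *.
  unfold Rminus; pose proof (HM n); pose proof (HN n); lra.
Qed.

Lemma bounded_seq_between m M a : (forall n, m <= a n <= M) -> bounded_seq a.
Proof.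
  intros H; exists (Rabs m + Rabs M); intros n; specialize (H n).
  apply Rabs_le; pose proof (Rle_abs m); pose proof (Rle_abs M).
  pose proof (Rle_abs (- m)); rewrite Rabs_Ropp in *.
  pose proof (Rabs_pos m); pose proof (Rabs_pos M); lra.
Qed.

Lemma wsum_minus a b : bounded_seq a -> bounded_seq b ->
  wsum (fun n => a n - b n) = wsum a - wsum b.
Proof.
  intros Ha Hb; rewrite (wsum_ext _ (fun n => a n + (-1) * b n)) by (intros; ring).
  rewrite wsum_plus, wsum_scal by (auto using bounded_seq_scal); ring.
Qed.

Lemma wsum_le a b : bounded_seq a -> bounded_seq b -> (forall n, a n <= b n) -> wsum a <= wsum b.
Proof.
  intros Ha Hb H; apply Rminus_le, Ropp_le_cancel.
  replace (- (wsum a - wsum b)) with (wsum (fun n => b n - a n)) by (rewrite wsum_minus; auto; ring).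
  replace (- 0) with (wsum (fun _ => 0)) by (rewrite wsum_const; ring).
  apply Series_le.
  - intros n; rewrite Rmult_0_l; split; [lra|].
    apply Rmult_le_pos; [specialize (H n); lra|apply Rlt_le, half_pow_pos].
  - apply wsum_ex, bounded_seq_minus; auto.
Qed.

Lemma wsum_shift a : bounded_seq a -> wsum a = a O + / 2 * wsum (fun n => a (S n)).
Proof.
  intros Ha; unfold wsum; rewrite Series_incr_1 by (apply wsum_ex; auto).
  rewrite <- Series_scal_l; simpl; rewrite Rmult_1_r; f_equal.
  apply Series_ext; intros n; field.
Qed.

Lemma bounded_seq_shift a : bounded_seq a -> bounded_seq (fun n => a (S n)).
Proof. intros [M HM]; exists M; intros n; apply HM. Qed.

Lemma wsum_nonneg a : bounded_seq a -> (forall n, 0 <= a n) -> 0 <= wsum a.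
Proof.
  intros Ha H; replace 0 with (wsum (fun _ => 0)) by (rewrite wsum_const; ring).
  apply wsum_le; auto using bounded_seq_const.
Qed.

Lemma wsum_ge_term a n : bounded_seq a -> (forall n, 0 <= a n) -> a n * (1 / 2) ^ n <= wsum a.
Proof.
  revert a; induction n as [|n IH]; intros a Ha H; rewrite (wsum_shift a Ha).
  - pose proof (wsum_nonneg _ (bounded_seq_shift a Ha) (fun k => H (S k))); simpl; lra.
  - specialize (IH _ (bounded_seq_shift a Ha) (fun k => H (S k))).
    pose proof (H O); simpl; lra.
Qed.

(** Turns control of finitely many terms into control of the sum: all weights together amount to 2,
    those from [N] on to [2 * (1 / 2) ^ N]. *)
Lemma wsum_split_le a eps M N : bounded_seq a -> (forall n, a n <= M) ->
  (forall n, (n < N)%nat -> a n <= eps) -> 0 <= eps ->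
  wsum a <= 2 * eps + 2 * M * (1 / 2) ^ N.
Proof.
  revert a; induction N as [|N IH]; intros a Ha HM He H0.
  - pose proof (wsum_le a (fun _ => M) Ha (bounded_seq_const M) HM) as H.
    rewrite wsum_const in H; simpl; lra.
  - rewrite (wsum_shift a Ha).
    specialize (IH _ (bounded_seq_shift a Ha) (fun k => HM (S k))
      (fun k Hk => He (S k) (proj1 (Nat.succ_lt_mono _ _) Hk)) H0).
    pose proof (He O ltac:(lia)); simpl; lra.
Qed.

Lemma wsum_abs a M : (forall n, Rabs (a n) <= M) -> Rabs (wsum a) <= 2 * M.
Proof.
  intros H; assert (Ha : bounded_seq a) by (exists M; auto).
  assert (Hb : forall n, - M <= a n <= M) by (intros n; apply Rabs_le_between, H).
  apply Rabs_le; replace (- (2 * M)) with (2 * - M) by ring; rewrite <- !wsum_const.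
  split; apply wsum_le; auto using bounded_seq_const; intros n; apply Hb.
Qed.

Lemma psum_shift a n : psum a (S n) = a O + / 2 * psum (fun k => a (S k)) n.
Proof.
  induction n as [|n IH]; [simpl; ring|].
  change (psum a (S n) + a (S n) * (1 / 2) ^ (S n) =
          a O + / 2 * (psum (fun k => a (S k)) n + a (S n) * (1 / 2) ^ n)).
  rewrite IH; simpl; field.
Qed.

Lemma psum_le_wsum a n : bounded_seq a -> (forall n, 0 <= a n) -> psum a n <= wsum a.
Proof.
  revert a; induction n as [|n IH]; intros a Ha H.
  - apply wsum_nonneg; auto.
  - rewrite psum_shift, (wsum_shift a Ha).
    specialize (IH _ (bounded_seq_shift a Ha) (fun k => H (S k))); lra.
Qed.

Lemma wsum_le_psum a M n : bounded_seq a -> (forall n, a n <= M) ->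
  wsum a <= psum a n + 2 * M * (1 / 2) ^ n.
Proof.
  revert a; induction n as [|n IH]; intros a Ha H.
  - pose proof (wsum_le a (fun _ => M) Ha (bounded_seq_const M) H) as H1.
    rewrite wsum_const in H1; simpl; lra.
  - rewrite psum_shift, (wsum_shift a Ha).
    specialize (IH _ (bounded_seq_shift a Ha) (fun k => H (S k))); simpl; lra.
Qed.

(** Convexity enters as the global subgradient inequality, so that Frechet differentiability only
    leaves the upper estimate to be stated. Both halves pass to sums, rescalings and weighted
    series. *)
Definition gradient {X : NormedSpace} (theta : X -> R) (L : R) (x : X) (D : X -> R) : Prop :=
  linear_form D /\ bounded_by L D /\
  (forall h, theta x + D h <= theta (x +' h)) /\
  (forall eps, 0 < eps -> exists delta, 0 < delta /\
     forall h, vnorm h < delta -> theta (x +' h) <= theta x + D h + eps * vnorm h).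

Definition smooth_convex {X : NormedSpace} (theta : X -> R) (L : R) : Prop :=
  forall x, exists D, gradient theta L x D.

Section SmoothConvex.
Context {X : NormedSpace}.
Implicit Types (theta t : X -> R).

Lemma smooth_convex_lipschitz theta L x y :
  smooth_convex theta L -> theta x - theta y <= L * vnorm (x -' y).
Proof.
  intros H; destruct (H x) as (D & _ & Hb & Hsub & _).
  pose proof (Hsub (y -' x)) as H1.
  replace (x +' (y -' x)) with y in H1 by vec.
  pose proof (bounded_by_le _ _ (y -' x) Hb) as H2.
  rewrite vnorm_sub_sym in H2; lra.
Qed.

(** Dividing by [lam] keeps the Lipschitz constant; [lam = 1] gives translations, [lam = 2 ^ j] the
    zooms of the gauge construction. *)
Lemma gradient_rescale theta L lam x0 x D : 0 < lam ->
  gradient theta L (lam *' (x -' x0)) D ->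
  gradient (fun x => theta (lam *' (x -' x0)) / lam) L x D.
Proof.
  intros Hl (Hlin & Hb & Hsub & Hsup); split; [auto|split; [auto|split]].
  - intros h; specialize (Hsub (lam *' h)).
    replace (lam *' (x +' h -' x0)) with (lam *' (x -' x0) +' lam *' h) by vec.
    rewrite (proj2 Hlin) in Hsub.
    apply (Rmult_le_compat_r (/ lam)) in Hsub; [|apply Rlt_le, Rinv_0_lt_compat; auto].
    unfold Rdiv.
    replace ((theta (lam *' (x -' x0)) + lam * D h) * / lam)
      with (theta (lam *' (x -' x0)) * / lam + D h) in Hsub by (field; lra); exact Hsub.
  - intros eps He; destruct (Hsup eps He) as (delta & Hd & H).
    exists (delta / lam); split; [apply Rdiv_lt_0_compat; auto|].
    intros h Hh; specialize (H (lam *' h)).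
    rewrite vnorm_scal_nonneg, (proj2 Hlin) in H by lra.
    replace (lam *' (x +' h -' x0)) with (lam *' (x -' x0) +' lam *' h) by vec.
    assert (Hh' : lam * vnorm h < delta).
    { apply (Rmult_lt_compat_l lam) in Hh; auto.
      replace (lam * (delta / lam)) with delta in Hh by (field; lra); exact Hh. }
    specialize (H Hh'); apply (Rmult_le_compat_r (/ lam)) in H;
      [|apply Rlt_le, Rinv_0_lt_compat; auto].
    unfold Rdiv.
    replace ((theta (lam *' (x -' x0)) + lam * D h + eps * (lam * vnorm h)) * / lam)
      with (theta (lam *' (x -' x0)) * / lam + D h + eps * vnorm h) in H by (field; lra); exact H.
Qed.

Lemma gradient_reflect theta L x D :
  gradient theta L (-' x) D -> gradient (fun x => theta (-' x)) L x (fun h => D (-' h)).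
Proof.
  intros (Hlin & Hb & Hsub & Hsup); split; [|split; [|split]].
  - split; intros.
    + rewrite <- (proj1 Hlin); f_equal; vec.
    + rewrite <- (proj2 Hlin); f_equal; vec.
  - intros h; rewrite <- (vnorm_opp h); apply Hb.
  - intros h; replace (-' (x +' h)) with (-' x +' -' h) by vec; apply Hsub.
  - intros eps He; destruct (Hsup eps He) as (delta & Hd & H); exists delta; split; auto.
    intros h Hh; replace (-' (x +' h)) with (-' x +' -' h) by vec.
    rewrite <- (vnorm_opp h); apply H; rewrite vnorm_opp; auto.
Qed.

Lemma gradient_combine t1 t2 L1 L2 x D1 D2 :
  gradient t1 L1 x D1 -> gradient t2 L2 x D2 ->
  gradient (fun x => t1 x + t2 x) (L1 + L2) x (fun h => D1 h + D2 h).
Proof.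
  intros (Hlin1 & Hb1 & Hsub1 & Hsup1) (Hlin2 & Hb2 & Hsub2 & Hsup2).
  split; [|split; [|split]].
  - split; intros; rewrite ?(proj1 Hlin1), ?(proj1 Hlin2), ?(proj2 Hlin1), ?(proj2 Hlin2); ring.
  - intros h; pose proof (Rabs_triang (D1 h) (D2 h)); pose proof (Hb1 h); pose proof (Hb2 h); lra.
  - intros h; pose proof (Hsub1 h); pose proof (Hsub2 h); lra.
  - intros eps He; destruct (Hsup1 (eps / 2)) as (d1 & Hd1 & H1); [lra|].
    destruct (Hsup2 (eps / 2)) as (d2 & Hd2 & H2); [lra|].
    exists (Rmin d1 d2); split; [apply Rmin_pos; auto|].
    intros h Hh; specialize (H1 h (Rlt_le_trans _ _ _ Hh (Rmin_l _ _))).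
    specialize (H2 h (Rlt_le_trans _ _ _ Hh (Rmin_r _ _))); lra.
Qed.

Lemma gradient_scale c t L x D : 0 <= c ->
  gradient t L x D -> gradient (fun x => c * t x) (c * L) x (fun h => c * D h).
Proof.
  intros Hc (Hlin & Hb & Hsub & Hsup); split; [|split; [|split]].
  - split; intros; rewrite ?(proj1 Hlin), ?(proj2 Hlin); ring.
  - intros h; rewrite Rabs_mult, (Rabs_pos_eq c), Rmult_assoc by auto.
    apply Rmult_le_compat_l; auto.
  - intros h; specialize (Hsub h); nra.
  (* The denominator is [c + 1] because [c] may be zero. *)
  - intros eps He; destruct (Hsup (eps / (c + 1))) as (d & Hd & H);
      [apply Rdiv_lt_0_compat; lra|].
    exists d; split; auto; intros h Hh; specialize (H h Hh).
    apply (Rmult_le_compat_l c) in H; auto.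
    assert (c * (eps / (c + 1) * vnorm h) <= eps * vnorm h); [|lra].
    rewrite <- Rmult_assoc; apply Rmult_le_compat_r; [apply vnorm_nonneg|].
    apply Rmult_le_reg_r with (c + 1); [lra|].
    replace (c * (eps / (c + 1)) * (c + 1)) with (c * eps) by (field; lra); nra.
Qed.

Lemma gradient_ext t1 t2 L x D : (forall x, t1 x = t2 x) -> gradient t1 L x D -> gradient t2 L x D.
Proof.
  intros He (Hlin & Hb & Hsub & Hsup); split; [|split; [|split]]; auto.
  - intros h; rewrite <- !He; auto.
  - intros eps H; destruct (Hsup eps H) as (d & Hd & H'); exists d; split; auto.
    intros; rewrite <- !He; auto.
Qed.

(* The tails of the series are uniformly Lipschitz with small constant, so they do not
   affect the first-order expansion. *)
Lemma smooth_convex_wsum (t : nat -> X -> R) L : 0 <= L ->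
  (forall n, smooth_convex (t n) L) -> (forall x, bounded_seq (fun n => t n x)) ->
  smooth_convex (fun x => wsum (fun n => t n x)) (2 * L).
Proof.
  intros HL Ht Hbd x.
  destruct (choice (fun n D => gradient (t n) L x D) (fun n => Ht n x)) as [D HD].
  assert (HDb : forall h n, Rabs (D n h) <= L * vnorm h) by (intros h n; apply HD).
  assert (HDs : forall h, bounded_seq (fun n => D n h)) by (intros h; eexists; apply HDb).
  exists (fun h => wsum (fun n => D n h)); split; [|split; [|split]].
  - split; intros.
    + rewrite <- wsum_plus by auto; apply wsum_ext; intros n; apply HD.
    + rewrite <- wsum_scal; apply wsum_ext; intros n; apply HD.
  - intros h; rewrite Rmult_assoc; apply wsum_abs, HDb.
  - intros h; rewrite <- wsum_plus by auto; apply wsum_le; auto.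
    + apply bounded_seq_plus; auto.
    + intros n; apply HD.
  - intros eps He.
    (* Each remainder is at most [2 * L * vnorm h], so the tail from [N] on costs at most
       [eps / 2 * vnorm h]; the first [N] remainders, each at most [eps / 4 * vnorm h], cost the
       other half. *)
    destruct (half_pow_small (eps / (8 * (L + 1)))) as [N HN]; [apply Rdiv_lt_0_compat; lra|].
    assert (Hdel : exists d, 0 < d /\ forall h, vnorm h < d -> forall n, (n < N)%nat ->
              t n (x +' h) - t n x - D n h <= eps / 4 * vnorm h).
    { clear HN; induction N as [|N (d & Hd & IH)].
      - exists 1; split; [lra|intros; lia].
      - destruct (HD N) as (_ & _ & _ & H); destruct (H (eps / 4)) as (d' & Hd' & H'); [lra|].
        exists (Rmin d d'); split; [apply Rmin_pos; auto|].
        intros h Hh n Hn; destruct (Nat.eq_dec n N) as [->|].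
        + specialize (H' h (Rlt_le_trans _ _ _ Hh (Rmin_r _ _))); lra.
        + apply IH; [apply (Rlt_le_trans _ _ _ Hh (Rmin_l _ _))|lia]. }
    destruct Hdel as (d & Hd & Hdel); exists d; split; auto; intros h Hh.
    pose proof (vnorm_nonneg h) as Hh0.
    assert (Hle : wsum (fun n => t n (x +' h) - t n x - D n h)
                  <= 2 * (eps / 4 * vnorm h) + 2 * (2 * L * vnorm h) * (1 / 2) ^ N).
    { apply wsum_split_le.
      - auto using bounded_seq_minus.
      - intros n; pose proof (smooth_convex_lipschitz _ _ (x +' h) x (Ht n)) as H1.
        replace (x +' h -' x) with h in H1 by vec.
        pose proof (bounded_by_le _ _ h (proj1 (proj2 (HD n)))); lra.
      - intros n Hn; apply Hdel; auto.
      - nra. }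
    rewrite !wsum_minus in Hle by auto using bounded_seq_minus.
    assert (2 * (2 * L * vnorm h) * (1 / 2) ^ N <= eps / 2 * vnorm h); [|lra].
    pose proof (half_pow_pos N).
    apply Rle_trans with (4 * (L + 1) * (eps / (8 * (L + 1))) * vnorm h).
    + assert (4 * L * (1 / 2) ^ N <= 4 * (L + 1) * (eps / (8 * (L + 1)))); [|nra].
      apply Rmult_le_compat; lra.
    + right; field; lra.
Qed.

End SmoothConvex.

(** * A smooth gauge when the dual is separable *)

Definition bounded_form {X : NormedSpace} (f : X -> R) : Prop :=
  exists M, 0 <= M /\ bounded_by M f.

Definition opnorm {X : NormedSpace} (f : X -> R) : R :=
  Rinf (fun M => 0 <= M /\ bounded_by M f).

Lemma opnorm_nonneg {X : NormedSpace} (f : X -> R) : bounded_form f -> 0 <= opnorm f.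
Proof.
  intros Hf; apply (Rinf_spec (fun M => 0 <= M /\ bounded_by M f) 0); auto; intros M [H _]; exact H.
Qed.

Lemma opnorm_le {X : NormedSpace} (f : X -> R) M : 0 <= M -> bounded_by M f -> opnorm f <= M.
Proof.
  intros H0 H; apply (Rinf_spec (fun M => 0 <= M /\ bounded_by M f) 0); [exists M; auto| |auto].
  intros N [HN _]; exact HN.
Qed.

Lemma opnorm_bound {X : NormedSpace} (f : X -> R) : bounded_form f -> bounded_by (opnorm f) f.
Proof.
  intros Hf x; apply le_epsilon; intros eps He.
  pose proof (vnorm_nonneg x) as Hx.
  destruct (Rinf_approx (fun M => 0 <= M /\ bounded_by M f) 0 (eps / (vnorm x + 1)))
    as (M & [HM0 HM] & Hlt); auto.
  - intros M [H _]; exact H.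
  - apply Rdiv_lt_0_compat; lra.
  - fold (opnorm f) in Hlt.
    eapply Rle_trans; [apply HM|].
    apply Rle_trans with ((opnorm f + eps / (vnorm x + 1)) * vnorm x);
      [apply Rmult_le_compat_r; lra|].
    rewrite Rmult_plus_distr_r; apply Rplus_le_compat_l.
    apply Rmult_le_reg_r with (vnorm x + 1); [lra|].
    replace (eps / (vnorm x + 1) * vnorm x * (vnorm x + 1)) with (eps * vnorm x) by (field; lra).
    nra.
Qed.

Lemma bounded_form_sub {X : NormedSpace} (f g : X -> R) :
  bounded_form f -> bounded_form g -> bounded_form (fun x => f x - g x).
Proof.
  intros (M & HM & HMf) (N & HN & HNg); exists (M + N); split; [lra|].
  intros x; pose proof (Rabs_triang (f x) (- g x)); rewrite Rabs_Ropp in *.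
  pose proof (HMf x); pose proof (HNg x); unfold Rminus; lra.
Qed.

Definition unit_form {X : NormedSpace} (f : X -> R) : Prop := linear_form f /\ bounded_by 1 f.

Lemma sqr_le_le a b : 0 <= b -> a ^ 2 <= b ^ 2 -> a <= b.
Proof. intros; nra. Qed.

Section SmoothGauge.
Context {X : NormedSpace} (gs : nat -> X -> R).
Hypothesis gs_dual : forall n, bounded_form (gs n).
Hypothesis gs_dense : forall g eps, linear_form g -> bounded_form g -> 0 < eps ->
  exists n, forall x, Rabs (g x - gs n x) <= eps * vnorm x.

(** Bounds the distance from [gs n] to any form of the dual unit ball, so that [dev] takes values in
    [0, 1] there and the weighted series converges. *)
Let scale n := 1 + opnorm (gs n).
Let dev n (f : X -> R) := opnorm (fun x => f x - gs n x) / scale n.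
(* If the penalties of [f], [g] and of their midpoint are nearly in balance, then [f] and [g]
   are at nearly equal distance from every [gs n]; taking [gs n] close to [g] makes [f] close
   to [g].  Hence nearly maximizing forms cluster, which is the smoothness of [theta0]. *)
Let penalty (f : X -> R) := wsum (fun n => dev n f ^ 2).
(** The convex conjugate of [penalty] on the dual unit ball: the supremum of [f x - penalty f],
    written as minus an infimum. *)
Let theta0 (x : X) := - Rinf (fun s => exists f, unit_form f /\ s = penalty f - f x).

Lemma scale_pos n : 0 < scale n.
Proof. unfold scale; pose proof (opnorm_nonneg _ (gs_dual n)); lra. Qed.

Lemma unit_form_bounded f : unit_form (X := X) f -> bounded_form f.
Proof. intros [_ H]; exists 1; split; [lra|auto]. Qed.

Lemma dev_bound n f : unit_form f ->
  bounded_by (dev n f * scale n) (fun x => f x - gs n x).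
Proof.
  intros Hf; unfold dev; pose proof (scale_pos n).
  replace (opnorm (fun x => f x - gs n x) / scale n * scale n)
    with (opnorm (fun x => f x - gs n x)) by (field; lra).
  apply opnorm_bound, bounded_form_sub; auto using unit_form_bounded.
Qed.

Lemma dev_le n f M : 0 <= M -> bounded_by (M * scale n) (fun x => f x - gs n x) -> dev n f <= M.
Proof.
  intros H0 H; pose proof (scale_pos n); unfold dev.
  apply Rmult_le_reg_r with (scale n); auto.
  replace (opnorm (fun x => f x - gs n x) / scale n * scale n)
    with (opnorm (fun x => f x - gs n x)) by (field; lra).
  apply opnorm_le; auto; nra.
Qed.

Lemma dev_range n f : unit_form f -> 0 <= dev n f <= 1.
Proof.
  intros Hf; pose proof (scale_pos n) as Hs; split.
  - unfold dev; apply Rmult_le_pos; [|apply Rlt_le, Rinv_0_lt_compat; auto].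
    apply opnorm_nonneg, bounded_form_sub; auto using unit_form_bounded.
  - apply dev_le; [lra|]; intros x.
    pose proof (Rabs_triang (f x) (- gs n x)); rewrite Rabs_Ropp in *.
    pose proof (proj2 Hf x); pose proof (opnorm_bound _ (gs_dual n) x).
    unfold scale, Rminus; lra.
Qed.

Lemma dev_sqr_range n f : unit_form f -> 0 <= dev n f ^ 2 <= 1.
Proof. intros Hf; pose proof (dev_range n f Hf); nra. Qed.

Lemma dev_sqr_bounded f : unit_form f -> bounded_seq (fun n => dev n f ^ 2).
Proof. intros Hf; apply (bounded_seq_between 0 1); intros n; apply dev_sqr_range; auto. Qed.

Lemma penalty_range f : unit_form f -> 0 <= penalty f <= 2.
Proof.
  intros Hf; split; [apply wsum_nonneg|]; auto using dev_sqr_bounded.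
  - intros n; apply dev_sqr_range; auto.
  - replace 2 with (2 * 1) by ring; rewrite <- wsum_const.
    apply wsum_le; auto using dev_sqr_bounded, bounded_seq_const.
    intros n; apply dev_sqr_range; auto.
Qed.

Lemma unit_form_zero : unit_form (fun _ : X => 0).
Proof.
  split; [split; intros; ring|].
  intros x; rewrite Rabs_R0; pose proof (vnorm_nonneg x); lra.
Qed.

Lemma cost_nonempty x : exists s, exists f, unit_form f /\ s = penalty f - f x.
Proof. eexists; exists (fun _ : X => 0); split; [apply unit_form_zero|reflexivity]. Qed.

Lemma cost_bound x s : (exists f, unit_form f /\ s = penalty f - f x) -> - vnorm x <= s.
Proof.
  intros (f & Hf & ->); pose proof (penalty_range f Hf).
  pose proof (bounded_by_le _ _ x (proj2 Hf)); lra.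
Qed.

Lemma theta0_ge x f : unit_form f -> f x - penalty f <= theta0 x.
Proof.
  intros Hf; unfold theta0.
  assert (Rinf (fun s => exists f, unit_form f /\ s = penalty f - f x) <= penalty f - f x); [|lra].
  apply (proj1 (Rinf_spec _ _ (cost_nonempty x) (cost_bound x))); eauto.
Qed.

Lemma theta0_approx x eps : 0 < eps -> exists f, unit_form f /\ theta0 x - eps < f x - penalty f.
Proof.
  intros He; destruct (Rinf_approx _ _ eps (cost_nonempty x) (cost_bound x) He)
    as (s & (f & Hf & ->) & Hs).
  exists f; split; auto; unfold theta0; lra.
Qed.

(** Parallelogram identity: [dev k] is convex, so its square at the midpoint falls below the mean of
    the squares by at least a quarter of the squared difference. The midpoint competes in
    [theta0 x], which bounds the sum of these gains; keeping the term of index [n] gives the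
    claim. *)
Lemma midpoint_defect n f g x : unit_form f -> unit_form g ->
  (dev n f - dev n g) ^ 2 * (1 / 2) ^ n
  <= 4 * theta0 x - 2 * (f x - penalty f) - 2 * (g x - penalty g).
Proof.
  intros Hf Hg; set (m := fun x => / 2 * (f x + g x)).
  assert (Hm : unit_form m).
  { destruct Hf as [Hfl Hf]; destruct Hg as [Hgl Hg]; unfold m; split.
    - split; intros; rewrite ?(proj1 Hfl), ?(proj1 Hgl), ?(proj2 Hfl), ?(proj2 Hgl); ring.
    - intros y; pose proof (bounded_by_le _ _ y Hf); pose proof (bounded_by_le _ _ y Hg).
      apply Rabs_le; lra. }
  assert (Hdev : forall k, dev k m <= / 2 * (dev k f + dev k g)).
  { intros k; pose proof (dev_range k f Hf); pose proof (dev_range k g Hg).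
    apply dev_le; [lra|]; intros y.
    pose proof (bounded_by_le _ _ y (dev_bound k f Hf)).
    pose proof (bounded_by_le _ _ y (dev_bound k g Hg)).
    unfold m; apply Rabs_le; lra. }
  pose proof (theta0_ge x m Hm) as H1; unfold m at 1 in H1.
  assert (Hb : bounded_seq (fun k => (dev k f - dev k g) ^ 2)).
  { apply (bounded_seq_between 0 1); intros k.
    pose proof (dev_range k f Hf); pose proof (dev_range k g Hg).
    pose proof (Rmult_le_pos (1 - (dev k f - dev k g)) (1 + (dev k f - dev k g))).
    split; [apply pow2_ge_0|lra]. }
  assert (H2 : penalty m + / 4 * wsum (fun k => (dev k f - dev k g) ^ 2)
               <= / 2 * penalty f + / 2 * penalty g).
  { unfold penalty; rewrite <- !wsum_scal, <- !wsum_plus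
      by auto using bounded_seq_scal, dev_sqr_bounded.
    apply wsum_le; auto using bounded_seq_plus, bounded_seq_scal, dev_sqr_bounded.
    intros k; pose proof (dev_range k m Hm); pose proof (Hdev k).
    assert (dev k m ^ 2 <= (/ 2 * (dev k f + dev k g)) ^ 2) by (apply pow_incr; lra).
    nra. }
  pose proof (wsum_ge_term _ n Hb (fun k => pow2_ge_0 _)) as H3; cbv beta in H3; lra.
Qed.

(* The maximizer is produced by Hahn-Banach below the upper limit of a maximizing sequence;
   this replaces weak-star compactness. *)
Lemma theta0_attained x : exists f, unit_form f /\ theta0 x <= f x - penalty f.
Proof.
  destruct (choice (fun k f => unit_form f /\ theta0 x - (1 / 2) ^ k < f x - penalty f)
              (fun k => theta0_approx x _ (half_pow_pos k))) as [F HF].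
  assert (HU : forall k, unit_form (F k)) by (intros k; apply HF).
  assert (Hmono : forall j k, (j <= k)%nat -> (1 / 2) ^ k <= (1 / 2) ^ j).
  { intros j k Hjk; induction Hjk; simpl; [lra|pose proof (half_pow_pos m); lra]. }
  (* Along a maximizing sequence [midpoint_defect] makes each deviation Cauchy: past the index [N]
     the defect is at most [4 * (1 / 2) ^ N]. *)
  assert (Hlim : forall n, exists b, forall eps, 0 < eps ->
            exists N, forall k, (N <= k)%nat -> Rabs (dev n (F k) - b) < eps).
  { intros n.
    assert (Hc : ex_finite_lim_seq (fun k => dev n (F k))).
    { apply ex_lim_seq_cauchy_corr; intros [eps He]; simpl.
      pose proof (half_pow_pos n) as Hn.
      destruct (half_pow_small (eps ^ 2 * (1 / 2) ^ n / 4)) as [N HN].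
      { pose proof (pow_lt eps 2 He); nra. }
      exists N; intros j k Hj Hk.
      pose proof (midpoint_defect n (F j) (F k) x (HU j) (HU k)) as H.
      pose proof (proj2 (HF j)); pose proof (proj2 (HF k)).
      pose proof (Hmono _ _ Hj); pose proof (Hmono _ _ Hk).
      assert (Hsq : (dev n (F j) - dev n (F k)) ^ 2 < eps ^ 2).
      { apply Rmult_lt_reg_r with ((1 / 2) ^ n); auto; lra. }
      apply Rabs_def1; nra. }
    destruct Hc as [b Hb]; exists b; intros eps He.
    destruct (proj1 (is_lim_seq_Reals _ _) Hb eps He) as [N HN].
    exists N; intros k Hk; apply (HN k Hk). }
  destruct (choice _ Hlim) as [b Hb]; clear Hlim.
  assert (Hb01 : forall n, 0 <= b n <= 1).
  { intros n; split; apply le_epsilon; intros eps He; destruct (Hb n eps He) as [N HN];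
      specialize (HN N (Nat.le_refl N)); apply Rabs_def2 in HN;
      pose proof (dev_range n (F N) (HU N)); lra. }
  destruct (hahn_banach (fun h s => forall eps, 0 < eps -> exists N, forall k, (N <= k)%nat ->
              F k h <= s + eps)) as (f & Hf & HQ).
  - intros h1 h2 s1 s2 H1 H2 eps He.
    destruct (H1 (eps / 2)) as [N1 HN1]; [lra|]; destruct (H2 (eps / 2)) as [N2 HN2]; [lra|].
    exists (max N1 N2); intros k Hk; rewrite (proj1 (proj1 (HU k))).
    specialize (HN1 k ltac:(lia)); specialize (HN2 k ltac:(lia)); lra.
  - intros t h s Ht H eps He; destruct (H (eps / t)) as [N HN]; [apply Rdiv_lt_0_compat; auto|].
    exists N; intros k Hk; rewrite (proj2 (proj1 (HU k))); specialize (HN k Hk).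
    apply (Rmult_le_compat_l t) in HN; [|lra].
    replace (t * (s + eps / t)) with (t * s + eps) in HN by (field; lra); auto.
  - intros h; exists (vnorm h); intros eps He; exists O; intros k _.
    pose proof (bounded_by_le _ _ h (proj2 (HU k))); lra.
  - intros s H; apply le_epsilon; intros eps He; destruct (H eps He) as [N HN].
    specialize (HN N (Nat.le_refl N)); rewrite linear_zero in HN by apply HU; lra.
  - assert (Hfu : unit_form f).
    { split; auto; apply linear_bounded_of_le; auto; intros h; apply HQ.
      intros eps He; exists O; intros k _.
      pose proof (bounded_by_le _ _ h (proj2 (HU k))); lra. }
    exists f; split; auto.
    (* Eventual upper bounds on [F k h] pass to [f h]; used at [h] and at its opposite, they carry
       the limit deviation over to [f]. *)
    assert (Hdev : forall n, dev n f <= b n).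
    { intros n; apply dev_le; [apply Hb01|].
      pose proof (scale_pos n) as Hs.
      assert (Hup : forall c h, c = 1 \/ c = -1 ->
                c * (f h - gs n h) <= b n * scale n * vnorm h).
      { intros c h Hc.
        assert (f (c *' h) <= c * gs n h + b n * scale n * vnorm h).
        { apply HQ; intros eps He; pose proof (vnorm_nonneg h) as Hh.
          destruct (Hb n (eps / (scale n * (vnorm h + 1)))) as [N HN];
            [apply Rdiv_lt_0_compat; nra|].
          exists N; intros k Hk; specialize (HN k Hk); apply Rabs_def2 in HN.
          pose proof (bounded_by_le _ _ h (dev_bound n (F k) (HU k))) as H.
          rewrite (proj2 (proj1 (HU k))).
          assert (dev n (F k) * scale n * vnorm h <= b n * scale n * vnorm h + eps).
          { apply Rle_trans with ((b n + eps / (scale n * (vnorm h + 1))) * (scale n * vnorm h)).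
            - rewrite Rmult_assoc; apply Rmult_le_compat_r; [nra|lra].
            - rewrite Rmult_plus_distr_r, <- Rmult_assoc; apply Rplus_le_compat_l.
              apply Rmult_le_reg_r with (vnorm h + 1); [lra|].
              replace (eps / (scale n * (vnorm h + 1)) * (scale n * vnorm h) * (vnorm h + 1))
                with (eps * vnorm h) by (field; split; lra); nra. }
          destruct Hc as [-> | ->]; lra. }
        rewrite (proj2 Hf) in H; lra. }
      intros h; apply Rabs_le; pose proof (Hup 1 h ltac:(auto));
        pose proof (Hup (-1) h ltac:(auto)); lra. }
    assert (Hbb : bounded_seq (fun n => b n ^ 2)).
    { apply (bounded_seq_between 0 1); intros n; specialize (Hb01 n); nra. }
    assert (Hpen : penalty f <= wsum (fun n => b n ^ 2)).
    { apply wsum_le; auto using dev_sqr_bounded; intros n.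
      pose proof (dev_range n f Hfu); pose proof (Hdev n); apply pow_incr; lra. }
    apply le_epsilon; intros eps He.
    destruct (half_pow_small (eps / 8)) as [N HN]; [lra|].
    assert (HK : exists K, forall k n, (K <= k)%nat -> (n < N)%nat ->
              b n ^ 2 - dev n (F k) ^ 2 <= eps / 8).
    { clear HN; induction N as [|N (K & IH)]; [exists O; intros; lia|].
      destruct (Hb N (eps / 16)) as [K' HK']; [lra|].
      exists (max K K'); intros k n Hk Hn; destruct (Nat.eq_dec n N) as [->|]; [|apply IH; lia].
      specialize (HK' k ltac:(lia)); apply Rabs_def2 in HK'.
      pose proof (Hb01 N); pose proof (dev_range N (F k) (HU k)); nra. }
    destruct HK as [K HK].
    destruct (half_pow_small (eps / 4)) as [K2 HK2]; [lra|].
    (* At [-' x] the upper bound on [f] becomes the lower bound on [f x] that makes [f] a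
       maximizer. *)
    assert (Hneg : f (-' x) <= - (theta0 x + wsum (fun n => b n ^ 2)) + eps).
    { apply HQ; intros eps' He'; exists (max K K2); intros k Hk.
      assert (wsum (fun n => b n ^ 2 - dev n (F k) ^ 2) <= 2 * (eps / 8) + 2 * 1 * (1 / 2) ^ N).
      { apply wsum_split_le.
        - auto using bounded_seq_minus, dev_sqr_bounded.
        - intros n; specialize (Hb01 n); pose proof (dev_sqr_range n (F k) (HU k)); nra.
        - intros n Hn; apply HK; auto; lia.
        - lra. }
      rewrite wsum_minus in H by auto using dev_sqr_bounded; fold (penalty (F k)) in H.
      pose proof (proj2 (HF k)); pose proof (Hmono K2 k ltac:(lia)).
      rewrite linear_opp by apply HU; lra. }
    rewrite linear_opp in Hneg by auto; lra.
Qed.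

Lemma theta0_maximizers_cluster x f0 eps : unit_form f0 -> theta0 x <= f0 x - penalty f0 ->
  0 < eps -> exists gam, 0 < gam /\ forall f, unit_form f -> theta0 x - gam <= f x - penalty f ->
    forall h, Rabs (f h - f0 h) <= eps * vnorm h.
Proof.
  intros Hf0 Hmax He.
  destruct (gs_dense f0 (eps / 4)) as [n Hn]; [apply Hf0|auto using unit_form_bounded|lra|].
  pose proof (scale_pos n) as Hs; pose proof (half_pow_pos n) as Hp.
  set (r := eps / 4 / scale n).
  assert (Hr : 0 < r) by (apply Rdiv_lt_0_compat; lra).
  (* As [f0] is a maximizer, the defect is at most [2 * gam], so the deviations from [gs n] differ
     by at most [r]. That of [f0] is at most [r], hence [f] is within [eps / 2] of [gs n], and
     [gs n] within [eps / 4] of [f0]. *)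
  exists (r ^ 2 * (1 / 2) ^ n / 2); split; [pose proof (pow_lt r 2 Hr); nra|].
  intros f Hf Hnear h.
  pose proof (midpoint_defect n f f0 x Hf Hf0) as Hd.
  assert (Hsq : (dev n f - dev n f0) ^ 2 <= r ^ 2).
  { apply Rmult_le_reg_r with ((1 / 2) ^ n); auto; lra. }
  apply sqr_le_le in Hsq; [|lra].
  assert (Hf0n : dev n f0 <= r).
  { apply dev_le; [lra|]; intros y; unfold r.
    replace (eps / 4 / scale n * scale n) with (eps / 4) by (field; lra); apply Hn. }
  pose proof (bounded_by_le _ _ h (dev_bound n f Hf)) as H1.
  pose proof (vnorm_nonneg h) as Hh.
  assert (H2 : dev n f * scale n * vnorm h <= eps / 2 * vnorm h).
  { apply Rmult_le_compat_r; auto.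
    apply Rle_trans with (2 * r * scale n); [apply Rmult_le_compat_r; lra|].
    unfold r; right; field; lra. }
  specialize (Hn h); apply Rabs_le_between in Hn; apply Rabs_le; nra.
Qed.

(** The derivative at [x] is the maximizer [f0]. A near maximizer at [x +' h] is, for small [h],
    still one at [x] because all forms in the ball are 1-Lipschitz; it is therefore close to [f0],
    and it controls the increment from above. *)
Lemma theta0_smooth : smooth_convex theta0 1.
Proof.
  intros x; destruct (theta0_attained x) as (f0 & Hf0 & Hmax); exists f0.
  assert (Hsub : forall h, theta0 x + f0 h <= theta0 (x +' h)).
  { intros h; pose proof (theta0_ge (x +' h) f0 Hf0) as H.
    rewrite (proj1 (proj1 Hf0)) in H; lra. }
  split; [apply Hf0|split; [apply Hf0|split; [exact Hsub|]]].
  intros eps He.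
  destruct (theta0_maximizers_cluster x f0 (eps / 2) Hf0 Hmax) as (gam & Hg & Hnear); [lra|].
  exists (gam / 4); split; [lra|]; intros h Hh.
  destruct (Req_dec (vnorm h) 0) as [H0|H0].
  { apply vnorm_eq0 in H0; subst h.
    rewrite vadd_zero, linear_zero, vnorm_vzero by apply Hf0; lra. }
  pose proof (vnorm_nonneg h).
  (* The first tolerance keeps [f] within [gam] of the maximum at [x]; the second is half of the
     error allowed. It has to be positive, whence the separate case [vnorm h = 0]. *)
  destruct (theta0_approx (x +' h) (Rmin (gam / 4) (eps / 2 * vnorm h))) as (f & Hf & Hfx).
  { apply Rmin_pos; [lra|]; apply Rmult_lt_0_compat; lra. }
  pose proof (Rmin_l (gam / 4) (eps / 2 * vnorm h)).
  pose proof (Rmin_r (gam / 4) (eps / 2 * vnorm h)).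
  rewrite (proj1 (proj1 Hf)) in Hfx.
  pose proof (Hsub h); pose proof (bounded_by_le _ _ h (proj2 Hf)).
  pose proof (bounded_by_le _ _ h (proj2 Hf0)).
  assert (Hd : Rabs (f h - f0 h) <= eps / 2 * vnorm h) by (apply Hnear; [auto|lra]).
  apply Rabs_le_between in Hd; pose proof (theta0_ge x f Hf); lra.
Qed.

Lemma theta0_growth x : vnorm x - 2 <= theta0 x.
Proof.
  destruct (norming_functional 1 (vnorm x) x) as (f & Hf & Hb & Hx); [lra|lra|].
  pose proof (theta0_ge x f (conj Hf Hb)); pose proof (penalty_range f (conj Hf Hb)); lra.
Qed.

Lemma theta0_at_zero : theta0 vzero <= 0.
Proof.
  apply le_epsilon; intros eps He; destruct (theta0_approx vzero eps He) as (f & Hf & H).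
  rewrite (linear_zero f) in H by apply Hf; pose proof (penalty_range f Hf); lra.
Qed.

(* [theta0] looks like the norm only at large scale; summing the rescalings
   [theta (2^j x) / 2^j] makes the function positive away from the origin at every scale. *)
Lemma smooth_gauge : exists theta : X -> R,
  smooth_convex theta 1 /\ theta vzero = 0 /\ (forall x, 0 <= theta x) /\
  forall rho, 0 < rho -> exists m, 0 < m /\ forall x, rho <= vnorm x -> m <= theta x.
Proof.
  (* Under symmetrization the subgradients at the origin cancel, so the origin becomes a minimum. *)
  set (t := fun x => theta0 x + theta0 (-' x) - 2 * theta0 vzero).
  assert (Ht : smooth_convex t 2).
  { intros x; destruct (theta0_smooth x) as [D HD]; destruct (theta0_smooth (-' x)) as [D' HD'].
    apply gradient_reflect in HD'.
    pose proof (gradient_combine _ _ _ _ _ _ _ HD HD') as (Hl & Hb & Hsub & Hsup).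
    replace (1 + 1) with 2 in Hb by ring.
    exists (fun h => D h + D' (-' h)); split; [auto|split; [auto|split]].
    - intros h; specialize (Hsub h); unfold t; lra.
    - intros eps He; destruct (Hsup eps He) as (d & Hd & H); exists d; split; auto.
      intros h Hh; specialize (H h Hh); unfold t; lra. }
  assert (Hneg0 : -' (vzero : X) = vzero) by vec.
  assert (Ht0 : t vzero = 0) by (unfold t; rewrite Hneg0; ring).
  assert (Htpos : forall x, 0 <= t x).
  { intros x; unfold t; destruct (theta0_smooth vzero) as (D & Hl & _ & Hsub & _).
    pose proof (Hsub x) as H1; pose proof (Hsub (-' x)) as H2.
    rewrite linear_opp in H2 by auto; rewrite vzero_add in *; lra. }
  assert (Htgrow : forall x, 2 * vnorm x - 4 <= t x).
  { intros x; unfold t; pose proof (theta0_growth x); pose proof (theta0_growth (-' x)).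
    rewrite vnorm_opp in *; pose proof theta0_at_zero; lra. }
  assert (Htlip : forall x, t x <= 2 * vnorm x).
  { intros x; pose proof (smooth_convex_lipschitz _ _ x vzero Ht) as H.
    rewrite Ht0 in H; replace (x -' vzero) with x in H by vec; lra. }
  assert (Hpow : forall j, 0 < 2 ^ j) by (intros; apply pow_lt; lra).
  set (T := fun (j : nat) (x : X) => t (2 ^ j *' (x -' vzero)) / 2 ^ j).
  assert (HTr : forall x j, 0 <= T j x <= 2 * vnorm x).
  { intros x j; unfold T; replace (x -' vzero) with x by vec; specialize (Hpow j); split.
    - apply Rmult_le_pos; [apply Htpos|apply Rlt_le, Rinv_0_lt_compat; auto].
    - apply Rmult_le_reg_r with (2 ^ j); auto.
      replace (t (2 ^ j *' x) / 2 ^ j * 2 ^ j) with (t (2 ^ j *' x)) by (field; lra).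
      pose proof (Htlip (2 ^ j *' x)) as H; rewrite vnorm_scal_nonneg in H by lra; lra. }
  assert (HTb : forall x, bounded_seq (fun j => T j x)).
  { intros x; eapply bounded_seq_between; intros j; apply HTr. }
  assert (HT : smooth_convex (fun x => wsum (fun j => T j x)) (2 * 2)).
  { apply (smooth_convex_wsum T); [lra| |auto].
    intros j x; destruct (Ht (2 ^ j *' (x -' vzero))) as [D HD]; exists D.
    apply gradient_rescale; auto. }
  exists (fun x => / 4 * wsum (fun j => T j x)); split; [|split; [|split]].
  - intros x; destruct (HT x) as [D HD]; exists (fun h => / 4 * D h).
    replace 1 with (/ 4 * (2 * 2)) by field; apply gradient_scale; [lra|auto].
  - rewrite (wsum_ext _ (fun _ => 0)), wsum_const; [ring|].
    intros j; unfold T; replace (2 ^ j *' (vzero -' vzero)) with (vzero : X) by vec.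
    rewrite Ht0; unfold Rdiv; ring.
  - intros x; apply Rmult_le_pos; [lra|]; apply wsum_nonneg; auto; intros j; apply HTr.
  (* With this [j], [2 ^ j * vnorm x] exceeds 3, where the growth bound [2 * vnorm x - 4] of [t] is
     at least 2. *)
  - intros rho Hrho; destruct (half_pow_small (rho / 3)) as [j Hj]; [lra|].
    assert (H1 : 2 ^ j * (1 / 2) ^ j = 1).
    { rewrite <- Rpow_mult_distr; replace (2 * (1 / 2)) with 1 by field; apply pow1. }
    specialize (Hpow j); pose proof (half_pow_pos j) as Hhalf.
    exists (/ 4 * (2 / 2 ^ j * (1 / 2) ^ j)); split.
    + repeat apply Rmult_lt_0_compat; try lra; apply Rinv_0_lt_compat; auto.
    + intros x Hx; apply Rmult_le_compat_l; [lra|].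
      eapply Rle_trans; [|apply (wsum_ge_term _ j (HTb x)); intros; apply HTr].
      apply Rmult_le_compat_r; [lra|]; unfold T.
      replace (x -' vzero) with x by vec.
      apply Rmult_le_compat_r; [apply Rlt_le, Rinv_0_lt_compat; auto|].
      pose proof (Htgrow (2 ^ j *' x)) as H; rewrite vnorm_scal_nonneg in H by lra; nra.
Qed.

End SmoothGauge.

(** * Smooth variational principle *)

Definition vlim {X : NormedSpace} (x : nat -> X) (u : X) : Prop :=
  forall eps, 0 < eps -> exists N, forall n, (N <= n)%nat -> vnorm (x n -' u) < eps.

Lemma half_pow_antitone j k : (j <= k)%nat -> (1 / 2) ^ k <= (1 / 2) ^ j.
Proof.
  intros Hjk; induction Hjk; simpl; [lra|pose proof (half_pow_pos m); lra].
Qed.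

Section VariationalPrinciple.
Context {X : NormedSpace} (theta : X -> R).
Hypothesis banach : Banach X.
Hypothesis theta_smooth : smooth_convex theta 1.
Hypothesis theta_zero : theta vzero = 0.
Hypothesis theta_nonneg : forall x, 0 <= theta x.
Hypothesis theta_gauge : forall rho, 0 < rho ->
  exists m, 0 < m /\ forall x, rho <= vnorm x -> m <= theta x.

Variables (dom : X -> Prop) (g : X -> R) (m : R).
Hypothesis g_bounded : forall x, dom x -> m <= g x.
(** Sequential lower semicontinuity of the function equal to [g] on [dom] and infinite elsewhere;
    hence membership of the limit in [dom] is part of the conclusion, for sequences with bounded
    values. *)
Hypothesis g_lsc : forall (x : nat -> X) u r,
  vlim x u -> (forall n, dom (x n)) -> (forall n, g (x n) <= r) ->
  dom u /\ forall eps, 0 < eps -> exists N, forall n, (N <= n)%nat -> g u - eps <= g (x n).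

Lemma approximate_minimizer (P : X -> R) x eps : 0 < eps -> dom x -> (forall z, 0 <= P z) ->
  exists y, dom y /\ g y + P y <= g x + P x /\ forall z, dom z -> g y + P y <= g z + P z + eps.
Proof.
  intros He Hx HP; set (E := fun s => exists z, dom z /\ s = g z + P z).
  assert (HE : exists s, E s) by (exists (g x + P x), x; auto).
  assert (Hm : forall s, E s -> m <= s).
  { intros s (z & Hz & ->); pose proof (g_bounded z Hz); pose proof (HP z); lra. }
  assert (Hlow : forall z, dom z -> Rinf E <= g z + P z).
  { intros z Hz; apply (proj1 (Rinf_spec _ _ HE Hm)); exists z; auto. }
  destruct (Rinf_approx _ _ eps HE Hm He) as (s & (y & Hy & ->) & Hs).
  destruct (Rle_dec (g y + P y) (g x + P x)) as [H|H].
  - exists y; split; [auto|split; [auto|intros z Hz; pose proof (Hlow z Hz); lra]].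
  - exists x; split; [auto|split; [lra|intros z Hz; pose proof (Hlow z Hz); lra]].
Qed.

(** Each stage adds a bump centred at the current point and then nearly minimizes the perturbed
    function without increasing its value. The penalty is part of the recursive state, because the
    next point depends on all bumps so far. *)
Lemma variational_sequence (a : X) (c : R) (eps : nat -> R) :
  dom a -> 0 < c -> (forall n, 0 < eps n) ->
  exists (x : nat -> X) (P : nat -> X -> R),
    (forall z, P O z = 0) /\
    (forall n z, P (S n) z = P n z + c * (1 / 2) ^ n * theta (z -' x n)) /\
    (forall n, dom (x n)) /\ (forall n z, 0 <= P n z) /\
    g (x O) <= g a /\
    (forall n, g (x (S n)) + P (S n) (x (S n)) <= g (x n) + P (S n) (x n)) /\
    (forall n z, dom z -> g (x n) + P n (x n) <= g z + P n z + eps n).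
Proof.
  intros Ha Hc Heps.
  (* The choice function is total on states; its guarantee is conditional, and [Hinv] shows that the
     states reached satisfy the condition. *)
  destruct (choice (fun (t : nat * (X -> R) * X) y => let '(n, P, x) := t in
      dom x -> (forall z, 0 <= P z) ->
      dom y /\ g y + P y <= g x + P x /\ forall z, dom z -> g y + P y <= g z + P z + eps n))
    as [next Hnext].
  { intros [[n P] x]; destruct (classic (dom x /\ forall z, 0 <= P z)) as [[Hx HP]|Hn].
    - destruct (approximate_minimizer P x (eps n) (Heps n) Hx HP) as [y Hy]; exists y; auto.
    - exists x; intros Hx HP; destruct Hn; auto. }
  set (st := fix st n := match n with
    | O => (fun _ : X => 0, next (O, fun _ : X => 0, a))
    | S k => let P' := fun z => fst (st k) z + c * (1 / 2) ^ k * theta (z -' snd (st k)) in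
             (P', next (S k, P', snd (st k)))
    end).
  assert (Hinv : forall n, dom (snd (st n)) /\ forall z, 0 <= fst (st n) z).
  { induction n as [|n [IH1 IH2]].
    - split; [apply (Hnext (O, fun _ => 0, a)); auto; intros; lra|simpl; intros; lra].
    - assert (HP : forall z, 0 <= fst (st (S n)) z).
      { intros z; simpl; pose proof (IH2 z); pose proof (theta_nonneg (z -' snd (st n))).
        pose proof (half_pow_pos n).
        assert (0 <= c * (1 / 2) ^ n * theta (z -' snd (st n))); [|lra].
        apply Rmult_le_pos; auto; nra. }
      split; auto; apply (Hnext (S n, fst (st (S n)), snd (st n))); auto. }
  exists (fun n => snd (st n)), (fun n => fst (st n)).
  split; [reflexivity|split; [reflexivity|split; [apply Hinv|split; [apply Hinv|split; [|split]]]]].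
  - destruct (Hnext (O, fun _ => 0, a)) as (_ & H & _); auto; [intros; lra|].
    change (snd (st O)) with (next (O, fun _ : X => 0, a)); lra.
  - intros n; apply (Hnext (S n, fst (st (S n)), snd (st n))); apply Hinv.
  - intros [|n].
    + apply (Hnext (O, fun _ => 0, a)); auto; intros; lra.
    + apply (Hnext (S n, fst (st (S n)), snd (st n))); [apply Hinv|apply (proj2 (Hinv (S n)))].
Qed.

(** An argument of Borwein-Preiss type: the near minimizers form a Cauchy sequence, its limit is
    [u], and [Delta] is the sum of all bumps. Their weights add up to [2 * c], which gives the
    Lipschitz constant. *)
Lemma smooth_variational_principle (a : X) (c : R) : dom a -> 0 < c ->
  exists (Delta : X -> R) (u : X),
    smooth_convex Delta (2 * c) /\ dom u /\ (forall x, 0 <= Delta x) /\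
    g u + Delta u <= g a /\ forall x, dom x -> g u + Delta u <= g x + Delta x.
Proof.
  intros Ha Hc.
  destruct (choice (fun n mu => 0 < mu <= 1 /\ forall x, (1 / 2) ^ n <= vnorm x -> mu <= theta x))
    as [mu Hmu].
  { intros n; destruct (theta_gauge _ (half_pow_pos n)) as (mu & H0 & H).
    exists (Rmin mu 1); split; [split; [apply Rmin_pos; lra|apply Rmin_r]|].
    intros x Hx; eapply Rle_trans; [apply Rmin_l|auto]. }
  (* Half of what the bump at [x n] costs outside the ball of radius [(1 / 2) ^ n]: later points
     cannot afford to leave that ball. *)
  set (eps := fun n => c * (1 / 2) ^ n * (mu n / 2)).
  assert (Hcn : forall n, 0 < c * (1 / 2) ^ n).
  { intros n; apply Rmult_lt_0_compat; [auto|apply half_pow_pos]. }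
  assert (Heps : forall n, 0 < eps n).
  { intros n; apply Rmult_lt_0_compat; [apply Hcn|]; destruct (Hmu n); lra. }
  destruct (variational_sequence a c eps Ha Hc Heps)
    as (x & P & HP0 & HPS & Hdom & HPpos & Hxa & Hdec & Hmin).
  set (v := fun n => g (x n) + P n (x n)).
  assert (Hself : forall y : X, theta (y -' y) = 0).
  { intros y; replace (y -' y) with (vzero : X) by vec; auto. }
  assert (Hv : forall n k, (n <= k)%nat -> v k <= v n).
  { intros n k Hk; induction Hk as [|k Hk IH]; [lra|].
    eapply Rle_trans; [|exact IH]; unfold v; specialize (Hdec k).
    rewrite (HPS k (x k)), Hself in Hdec; lra. }
  assert (HPmono : forall n k z, (n <= k)%nat -> P n z <= P k z).
  { intros n k z Hk; induction Hk as [|k Hk IH]; [lra|].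
    rewrite HPS; pose proof (Hcn k); pose proof (theta_nonneg (z -' x k)); nra. }
  assert (Hclose : forall n k, (n <= k)%nat -> vnorm (x k -' x n) < (1 / 2) ^ n).
  { intros n k Hk; apply Rnot_le_lt; intros Hge.
    destruct (Nat.eq_dec n k) as [->|Hne].
    { rewrite vnorm_sub_self in Hge; pose proof (half_pow_pos k); lra. }
    destruct (Hmu n) as [Hmu0 Hmu1]; specialize (Hmu1 _ Hge).
    pose proof (Hmin n (x k) (Hdom k)) as H1.
    pose proof (Hv n k Hk) as H2; unfold v in H2.
    pose proof (HPmono (S n) k (x k) ltac:(lia)) as H3; rewrite HPS in H3.
    pose proof (Rmult_le_compat_l _ _ _ (Rlt_le _ _ (Hcn n)) Hmu1) as H4.
    unfold eps in H1; pose proof (Hcn n); nra. }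
  destruct (banach x) as [u Hu].
  { intros e He; destruct (half_pow_small (e / 2)) as [N HN]; [lra|].
    exists N; intros j k Hj Hk.
    pose proof (Hclose N j Hj); pose proof (Hclose N k Hk).
    pose proof (vnorm_sub_triangle (x j) (x N) (x k)) as H1.
    rewrite (vnorm_sub_sym (x N)) in H1; lra. }
  destruct (g_lsc x u (v O) Hu Hdom) as [Hdu Hlsc].
  { intros n; pose proof (Hv O n ltac:(lia)) as H; pose proof (HPpos n (x n)).
    unfold v at 1 in H; lra. }
  assert (HPlip : forall n z z', P n z - P n z' <= 2 * c * (1 - (1 / 2) ^ n) * vnorm (z -' z')).
  { induction n as [|n IH]; intros z z'; [rewrite !HP0; simpl; right; ring|].
    rewrite !HPS; specialize (IH z z').
    pose proof (smooth_convex_lipschitz theta 1 (z -' x n) (z' -' x n) theta_smooth) as H.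
    replace (z -' x n -' (z' -' x n)) with (z -' z') in H by vec.
    apply (Rmult_le_compat_l _ _ _ (Rlt_le _ _ (Hcn n))) in H; simpl; lra. }
  (* Pass to the limit along [x j]: [g] is lower semicontinuous, [P n] is Lipschitz and increases
     with [n], and [v] is nonincreasing. *)
  assert (Huv : forall n k, g u + P n u <= v k).
  { intros n k; apply le_epsilon; intros e He.
    destruct (Hlsc (e / 2)) as [N1 HN1]; [lra|].
    destruct (Hu (e / (4 * c))) as [N2 HN2]; [apply Rdiv_lt_0_compat; lra|].
    set (j := max (max N1 N2) (max n k)).
    specialize (HN1 j ltac:(lia)); specialize (HN2 j ltac:(lia)).
    pose proof (Hv k j ltac:(lia)) as H1; pose proof (HPmono n j (x j) ltac:(lia)) as H2.
    pose proof (HPlip n u (x j)) as H3; rewrite vnorm_sub_sym in H3.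
    unfold v at 1 in H1.
    assert (2 * c * (1 - (1 / 2) ^ n) * vnorm (x j -' u) <= e / 2); [|lra].
    pose proof (half_pow_pos n); pose proof (vnorm_nonneg (x j -' u)).
    apply Rle_trans with (2 * c * vnorm (x j -' u)).
    - apply Rmult_le_compat_r; auto; nra.
    - apply Rlt_le in HN2; apply (Rmult_le_compat_l (2 * c)) in HN2; [|lra].
      replace (2 * c * (e / (4 * c))) with (e / 2) in HN2 by (field; lra); auto. }
  set (t := fun n z => theta (z -' x n)).
  assert (Htb : forall z n, 0 <= t n z <= vnorm (z -' x O) + 1).
  { intros z n; split; [apply theta_nonneg|].
    pose proof (smooth_convex_lipschitz theta 1 (z -' x n) vzero theta_smooth) as H.
    replace (z -' x n -' vzero) with (z -' x n) in H by vec; rewrite theta_zero in H.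
    pose proof (vnorm_sub_triangle z (x O) (x n)) as H1.
    rewrite (vnorm_sub_sym (x O)) in H1; pose proof (Hclose O n ltac:(lia)); simpl in *.
    unfold t; lra. }
  assert (Htbs : forall z, bounded_seq (fun n => t n z)).
  { intros z; eapply bounded_seq_between; apply Htb. }
  assert (HPsum : forall n z, P n z = c * psum (fun n => t n z) n).
  { induction n as [|n IH]; intros z; [rewrite HP0; simpl; ring|].
    rewrite HPS, IH; simpl; unfold t; ring. }
  set (Delta := fun z => c * wsum (fun n => t n z)).
  assert (HPDelta : forall n z, P n z <= Delta z).
  { intros n z; rewrite HPsum; apply Rmult_le_compat_l; [lra|].
    apply psum_le_wsum; auto; intros k; apply Htb. }
  assert (Hfin : forall z e, 0 < e -> exists n, Delta z <= P n z + e /\ eps n <= e).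
  { intros z e He; set (M := vnorm (z -' x O) + 1).
    assert (HM : 0 < M) by (unfold M; pose proof (vnorm_nonneg (z -' x O)); lra).
    destruct (half_pow_small (e / (2 * c * M + c))) as [n Hn].
    { apply Rdiv_lt_0_compat; nra. }
    exists n.
    apply Rlt_le, (Rmult_le_compat_l (2 * c * M + c)) in Hn; [|nra].
    replace ((2 * c * M + c) * (e / (2 * c * M + c))) with e in Hn by (field; nra).
    pose proof (half_pow_pos n) as Hp.
    assert (0 <= c * M * (1 / 2) ^ n) by (apply Rmult_le_pos; nra).
    split.
    - rewrite HPsum; unfold Delta.
      pose proof (wsum_le_psum _ M n (Htbs z) (fun k => proj2 (Htb z k))) as H1.
      apply (Rmult_le_compat_l c) in H1; [|lra].
      pose proof (Hcn n); nra.
    - unfold eps; destruct (Hmu n) as [Hmu0 _]; pose proof (Hcn n); nra. }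
  exists Delta, u; split; [|split; [auto|split; [|split]]].
  - intros z.
    destruct (smooth_convex_wsum t 1 ltac:(lra)) with (x := z) as [D HD].
    + intros n y; destruct (theta_smooth (1 *' (y -' x n))) as [D HD]; exists D.
      apply gradient_rescale in HD; [|lra].
      apply (gradient_ext (fun y => theta (1 *' (y -' x n)) / 1)); auto.
      intros y'; unfold t; rewrite vscal_one; field.
    + exact Htbs.
    + exists (fun h => c * D h); replace (2 * c) with (c * (2 * 1)) by ring.
      apply gradient_scale; [lra|auto].
  - intros z; pose proof (HPDelta O z); rewrite HP0 in *; lra.
  - apply le_epsilon; intros e He; destruct (Hfin u e He) as (n & Hn & _).
    pose proof (Huv n O) as H; unfold v in H; rewrite HP0 in H; lra.
  - intros z Hz; apply le_epsilon; intros e He.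
    destruct (Hfin u (e / 2)) as (n & Hn & _); [lra|].
    destruct (Hfin z (e / 2)) as (k & _ & Hk); [lra|].
    pose proof (Huv n k); pose proof (Hmin k z Hz); pose proof (HPDelta k z).
    unfold v in *; lra.
Qed.

End VariationalPrinciple.

(** * Mean value theorem when the dual is separable *)

Definition seg {X : NormedSpace} (a b : X) (t : R) : X := a +' t *' (b -' a).

(** [frechet_subdiff] without quotient, with the value at [u] named and boundedness of [xi] kept
    apart; this form is the one that minimization and Hahn-Banach deliver. *)
Definition frechet_at {X : NormedSpace} (f : X -> ER) (u : X) (fu : R) (xi : X -> R) : Prop :=
  linear_form xi /\ f u = Fin fu /\
  forall eps, 0 < eps -> exists delta, 0 < delta /\
    forall h r, vnorm h < delta -> f (u +' h) = Fin r -> fu + xi h - eps * vnorm h <= r.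

Lemma R_lt_ER_weaken r r' e : r <= r' -> R_lt_ER r' e -> R_lt_ER r e.
Proof. destruct e; simpl; auto; lra. Qed.

Lemma vnorm_seg_sub {X : NormedSpace} (a b : X) s t :
  vnorm (seg a b s -' seg a b t) = Rabs (s - t) * vnorm (b -' a).
Proof. rewrite <- vnorm_scal; f_equal; unfold seg; vec. Qed.

(** Compactness of [0, 1]: points violating the conclusion at ever smaller distances have parameters
    clustering at some [l], where lower semicontinuity fails. The levels [- INR n] yield boundedness
    below near the segment, a constant level yields a uniform strict inequality. *)
Lemma lsc_segment_tube {X : NormedSpace} (f : X -> ER) (a b : X) (rho : nat -> R) :
  lsc f -> (forall j k, (j <= k)%nat -> rho k <= rho j) ->
  (forall t, 0 <= t <= 1 -> exists n, R_lt_ER (rho n) (f (seg a b t))) ->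
  exists n delta, 0 < delta /\ forall t x, 0 <= t <= 1 -> vnorm (x -' seg a b t) < delta ->
    R_lt_ER (rho n) (f x).
Proof.
  intros Hlsc Hrho Hseg; apply NNPP; intros Hn.
  assert (Hbad : forall n, exists tx : R * X, 0 <= fst tx <= 1 /\
            vnorm (snd tx -' seg a b (fst tx)) < (1 / 2) ^ n /\ ~ R_lt_ER (rho n) (f (snd tx))).
  { intros n; apply NNPP; intros Hno; apply Hn; exists n, ((1 / 2) ^ n).
    split; [apply half_pow_pos|]; intros t x Ht Hx; apply NNPP; intros Hf.
    apply Hno; exists (t, x); auto. }
  destruct (choice _ Hbad) as [w Hw]; clear Hbad Hn.
  destruct (Bolzano_Weierstrass (fun n => fst (w n)) (fun c => 0 <= c <= 1) (compact_P3 0 1))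
    as [l Hl]; [intros n; apply Hw|].
  assert (Hadh : forall e N, 0 < e -> exists p, (N <= p)%nat /\ Rabs (fst (w p) - l) < e).
  { intros e N He; destruct (Hl (fun s => Rabs (s - l) < e) N) as (p & Hp & H); [|eauto].
    exists (mkposreal e He); intros s Hs; exact Hs. }
  assert (Hl01 : 0 <= l <= 1).
  { split; apply le_epsilon; intros e He; destruct (Hadh e O He) as (p & _ & Hp);
      apply Rabs_def2 in Hp; destruct (Hw p) as [? _]; lra. }
  destruct (Hseg l Hl01) as [N HN].
  destruct (Hlsc _ _ HN) as (delta & Hd & Hdelta).
  destruct (half_pow_small (delta / 2)) as [N2 HN2]; [lra|].
  pose proof (vnorm_nonneg (b -' a)) as Hw0.
  destruct (Hadh (delta / (2 * (vnorm (b -' a) + 1))) (max N N2)) as (p & Hp & Hpl);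
    [apply Rdiv_lt_0_compat; lra|].
  destruct (Hw p) as (_ & Hx & Hf); apply Hf.
  apply (R_lt_ER_weaken _ (rho N)); [apply Hrho; lia|]; apply Hdelta.
  pose proof (vnorm_sub_triangle (snd (w p)) (seg a b (fst (w p))) (seg a b l)) as H1.
  rewrite vnorm_seg_sub in H1.
  pose proof (half_pow_antitone N2 p ltac:(lia)).
  assert (Rabs (fst (w p) - l) * vnorm (b -' a) <= delta / 2); [|lra].
  apply Rle_trans with (delta / (2 * (vnorm (b -' a) + 1)) * (vnorm (b -' a) + 1)).
  - pose proof (Rabs_pos (fst (w p) - l)); apply Rmult_le_compat; lra.
  - right; field; lra.
Qed.

Lemma segment_distance_attained {X : NormedSpace} (theta : X -> R) (a b x : X) :
  smooth_convex theta 1 ->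
  exists t, 0 <= t <= 1 /\
    forall s, 0 <= s <= 1 -> theta (x -' seg a b t) <= theta (x -' seg a b s).
Proof.
  intros Hth.
  destruct (continuity_ab_min (fun s => theta (x -' seg a b s)) 0 1) as (t & H & Ht); [lra| |eauto].
  intros c _ eps He.
  pose proof (vnorm_nonneg (b -' a)) as Hw.
  exists (eps / (vnorm (b -' a) + 1)); split; [apply Rdiv_lt_0_compat; lra|].
  intros s [_ Hs]; simpl in *; unfold R_dist in *.
  assert (Hd : forall p q, theta (x -' seg a b p) - theta (x -' seg a b q)
                           <= Rabs (p - q) * vnorm (b -' a)).
  { intros p q; rewrite <- vnorm_seg_sub, vnorm_sub_sym.
    replace (seg a b q -' seg a b p) with (x -' seg a b p -' (x -' seg a b q)) by vec.
    rewrite <- (Rmult_1_l (vnorm _)); apply smooth_convex_lipschitz; auto. }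
  pose proof (Hd s c) as H1; pose proof (Hd c s) as H2; rewrite (Rabs_minus_sym c s) in H2.
  apply Rle_lt_trans with (Rabs (s - c) * vnorm (b -' a)); [apply Rabs_le; lra|].
  pose proof (Rabs_pos (s - c)).
  apply Rle_lt_trans with (Rabs (s - c) * (vnorm (b -' a) + 1)); [nra|].
  apply (Rmult_lt_compat_r (vnorm (b -' a) + 1)) in Hs; [|lra].
  replace (eps / (vnorm (b -' a) + 1) * (vnorm (b -' a) + 1)) with eps in Hs by (field; lra); auto.
Qed.

Definition ER_val (e : ER) : R := match e with Fin r => r | PInf => 0 end.

Section MeanValue.
Context {X : NormedSpace} (gs : nat -> X -> R).
Hypothesis banach : Banach X.
Hypothesis gs_dual : forall n, bounded_form (gs n).
Hypothesis gs_dense : forall g eps, linear_form g -> bounded_form g -> 0 < eps ->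
  exists n, forall x, Rabs (g x - gs n x) <= eps * vnorm x.

(* Tilt [f] so that it is larger at [b] than at [a], penalize the (smooth) distance to the
   segment, and minimize.  Optimality in the segment parameter [t] makes the penalty gradient
   nonpositive along [b - a], so the penalty does not spoil the sign at the end. *)
Lemma mean_value_separable (f : X -> ER) (a b : X) (fa tau eps : R) :
  lsc f -> f a = Fin fa -> R_lt_ER fa (f b) -> 1 < tau -> 0 < eps ->
  exists u fu xi t K, 0 <= t < 1 /\ vnorm (u -' seg a b t) < eps /\
    frechet_at f u fu xi /\ 0 <= K /\ bounded_by K xi /\ 0 < xi (seg a b tau -' u).
Proof.
  intros Hlsc Hfa Hfb Htau Heps.
  destruct (smooth_gauge gs gs_dual gs_dense) as (theta & Hth & Hth0 & Hthpos & Hgauge).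
  assert (Hk : exists k, 0 < k /\ R_lt_ER (fa + 2 * k) (f b)).
  { destruct (f b) as [fb|]; simpl in *; [exists ((fb - fa) / 3)|exists 1]; split; auto; lra. }
  destruct Hk as (k & Hk & Hfbk).
  set (w := vnorm (b -' a)).
  assert (Hw : 0 < w).
  { destruct (vnorm_nonneg (b -' a)) as [H|H]; [exact H|].
    symmetry in H; apply vsub_eq0 in H; subst b; rewrite Hfa in Hfb; simpl in Hfb; lra. }
  (* The functional [l] of norm [A] grows by exactly [k] along [b -' a], half of the gap [2 * k], so
     [f - l] is still larger at [b] by [k]. *)
  set (A := k / w).
  assert (HA : 0 < A) by (apply Rdiv_lt_0_compat; auto).
  assert (HAw : A * w = k) by (unfold A; field; lra).
  destruct (norming_functional A k (b -' a)) as (l & Hl & Hlb & Hlk); [lra|fold w; lra|].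
  assert (Hlk' : l (b -' a) = k).
  { pose proof (bounded_by_le _ _ (b -' a) Hlb) as H; fold w in H; lra. }
  clear Hlk.
  destruct (lsc_segment_tube f a b (fun n => - INR n) Hlsc) as (n & d1 & Hd1 & Htube).
  { intros i j Hij; apply le_INR in Hij; lra. }
  { intros t _; destruct (f (seg a b t)) as [r|]; [|exists O; exact I].
    destruct (INR_unbounded (- r)) as [n Hn]; exists n; simpl; lra. }
  destruct (Hlsc b _ Hfbk) as (d2 & Hd2 & Hnearb).
  assert (Hdelta : exists delta, 0 < delta /\ delta <= eps /\ delta <= 1 /\ delta <= d1 /\
            delta <= d2 /\ delta <= w /\ delta <= (tau - 1) * w / 4).
  { exists (Rmin (Rmin (Rmin eps 1) (Rmin d1 d2)) (Rmin w ((tau - 1) * w / 4))).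
    assert (0 < (tau - 1) * w / 4) by nra.
    split; [repeat apply Rmin_pos; lra|].
    unfold Rmin; repeat destruct Rle_dec; repeat split; lra. }
  destruct Hdelta as (delta & Hd & Hde & Hde1 & Hdd1 & Hdd2 & Hdw & Hdt).
  destruct (Hgauge delta Hd) as (m0 & Hm0 & Hm0').
  assert (Hsmall : forall x, theta x < m0 -> vnorm x < delta).
  { intros x Hx; apply Rnot_le_lt; intros Hge; specialize (Hm0' x Hge); lra. }
  destruct (choice _ (fun x => segment_distance_attained theta a b x Hth)) as [T HT].
  set (dist := fun x => theta (x -' seg a b (T x))).
  assert (Hdist : forall x y, dist x <= dist y + vnorm (x -' y)).
  { intros x y; unfold dist; destruct (HT x) as [_ Hx]; destruct (HT y) as [Hy _].
    specialize (Hx (T y) Hy).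
    pose proof (smooth_convex_lipschitz theta 1 (x -' seg a b (T y)) (y -' seg a b (T y)) Hth) as H.
    replace (x -' seg a b (T y) -' (y -' seg a b (T y))) with (x -' y) in H by vec; lra. }
  assert (Hdist0 : forall x, 0 <= dist x) by (intros; apply Hthpos).
  set (low := - INR n - A * (vnorm a + w + 1)).
  (* Large enough to force [dist u < m0 / 4]: the minimizer is interior to the tube
     [dist x <= m0 / 2], so minimality on [dom] is a local statement about [f]. *)
  set (M := 4 * (Rabs (fa - l a - low) + 1) / m0).
  assert (HM : 0 < M).
  { apply Rdiv_lt_0_compat; auto; pose proof (Rabs_pos (fa - l a - low)); lra. }
  set (dom := fun x => dist x <= m0 / 2 /\ exists r, f x = Fin r).
  set (g := fun x => ER_val (f x) - l x + M * dist x).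
  assert (Hclose : forall x, dist x <= m0 / 2 -> vnorm (x -' seg a b (T x)) < delta).
  { intros x Hx; apply Hsmall; unfold dist in Hx; lra. }
  assert (HMd : forall x, 0 <= M * dist x) by (intros; apply Rmult_le_pos; auto; lra).
  assert (Hlow : forall x, dom x -> low <= ER_val (f x) - l x).
  { intros x [Hx [r Hr]]; rewrite Hr; simpl.
    pose proof (Hclose x Hx) as Hc; destruct (HT x) as [Ht01 _].
    pose proof (Htube (T x) x Ht01 ltac:(lra)) as H1; rewrite Hr in H1; simpl in H1.
    pose proof (bounded_by_le _ _ x Hlb) as H2.
    assert (Hxn : vnorm x <= vnorm a + w + 1).
    { pose proof (vnorm_le_sub x (seg a b (T x))) as H3.
      pose proof (vnorm_triangle X a (T x *' (b -' a))) as H4.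
      rewrite vnorm_scal_nonneg in H4 by lra; fold (seg a b (T x)) in H4; fold w in H4; nra. }
    apply (Rmult_le_compat_l A) in Hxn; [|lra]; unfold low; lra. }
  assert (Hseg0 : seg a b 0 = a) by (unfold seg; vec).
  assert (Hseg1 : seg a b 1 = b) by (unfold seg; vec).
  assert (Hdista : dist a = 0).
  { apply Rle_antisym; [|auto]; destruct (HT a) as [_ H]; specialize (H 0 ltac:(lra)).
    rewrite Hseg0 in H; replace (a -' a) with (vzero : X) in H by vec; unfold dist; lra. }
  assert (Hga : g a = fa - l a) by (unfold g; rewrite Hfa, Hdista; simpl; ring).
  set (c := (tau - 1) * k / (8 * (tau * w + 1))).
  assert (Htw : 0 < tau * w) by nra.
  assert (Hc : 0 < c) by (apply Rdiv_lt_0_compat; nra).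
  destruct (smooth_variational_principle theta banach Hth Hth0 Hthpos Hgauge dom g low)
    with (a := a) (c := c) as (Delta & u & HDelta & Hdu & HDpos & Hgu & Hmin); auto.
  { intros x Hx; pose proof (Hlow x Hx); pose proof (HMd x); unfold g; lra. }
  { intros x u r Hxu Hdx Hgx.
    assert (Hdu : dist u <= m0 / 2).
    { apply le_epsilon; intros e He; destruct (Hxu e He) as [N HN].
      specialize (HN N (Nat.le_refl N)); pose proof (Hdist u (x N)) as H.
      rewrite vnorm_sub_sym in H; destruct (Hdx N) as [H1 _]; lra. }
    assert (Hlx : forall e, 0 < e -> exists N, forall n, (N <= n)%nat ->
              vnorm (x n -' u) < e /\ - e <= l (x n) - l u <= e).
    { intros e He; destruct (Hxu (Rmin e (e / A))) as [N HN].
      { apply Rmin_pos; auto; apply Rdiv_lt_0_compat; auto. }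
      exists N; intros i Hi; specialize (HN i Hi).
      pose proof (Rmin_l e (e / A)); pose proof (Rmin_r e (e / A)).
      pose proof (bounded_by_le _ _ (x i -' u) Hlb) as H1; rewrite (linear_sub l) in H1 by auto.
      assert (A * vnorm (x i -' u) <= e); [|lra].
      apply Rle_trans with (A * (e / A)); [apply Rmult_le_compat_l; lra|right; field; lra]. }
    assert (Hfin : exists fu, f u = Fin fu).
    { destruct (f u) as [fu|] eqn:Hfu; [eauto|exfalso].
      destruct (Hlsc u (r + l u + 1)) as (e & He & Hball); [rewrite Hfu; exact I|].
      destruct (Hlx (Rmin e 1)) as [N HN]; [apply Rmin_pos; lra|].
      destruct (HN N (Nat.le_refl N)) as [H1 H2].
      pose proof (Rmin_l e 1); pose proof (Rmin_r e 1).
      specialize (Hball (x N) ltac:(lra)); destruct (Hdx N) as [_ [s Hs]].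
      pose proof (Hgx N) as H3; unfold g in H3; rewrite Hs in *; simpl in *.
      pose proof (HMd (x N)); lra. }
    split; [split; auto|].
    destruct Hfin as [fu Hfu]; intros e He.
    destruct (Hlsc u (fu - e / 4)) as (d & Hd' & Hball); [rewrite Hfu; simpl; lra|].
    destruct (Hlx (Rmin d (Rmin (e / 4) (e / (4 * M))))) as [N HN].
    { repeat apply Rmin_pos; auto; [lra|apply Rdiv_lt_0_compat; lra]. }
    exists N; intros i Hi; destruct (HN i Hi) as [H1 H2].
    assert (Hmins : Rmin d (Rmin (e / 4) (e / (4 * M))) <= d /\
                    Rmin d (Rmin (e / 4) (e / (4 * M))) <= e / 4 /\
                    Rmin d (Rmin (e / 4) (e / (4 * M))) <= e / (4 * M)).
    { unfold Rmin; repeat destruct Rle_dec; repeat split; lra. }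
    destruct Hmins as (Hm1 & Hm2 & Hm3).
    specialize (Hball (x i) ltac:(lra)); destruct (Hdx i) as [_ [s Hs]].
    unfold g; rewrite Hfu; rewrite Hs in *; simpl in *.
    pose proof (Hdist u (x i)) as H3; rewrite vnorm_sub_sym in H3.
    assert (H4 : M * dist u <= M * dist (x i) + e / 4); [|lra].
    apply Rle_trans with (M * (dist (x i) + e / (4 * M))).
    - apply Rmult_le_compat_l; lra.
    - right; field; lra. }
  { split; [rewrite Hdista; lra|eauto]. }
  destruct Hdu as [Hdu [fu Hfu]].
  assert (Hgval : g u = fu - l u + M * dist u) by (unfold g; rewrite Hfu; reflexivity).
  assert (Hdu4 : dist u < m0 / 4).
  { pose proof (Hlow u (conj Hdu (ex_intro _ fu Hfu))) as H1; rewrite Hfu in H1; simpl in H1.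
    pose proof (HDpos u); pose proof (Rle_abs (fa - l a - low)).
    apply Rmult_lt_reg_l with M; auto.
    replace (M * (m0 / 4)) with (Rabs (fa - l a - low) + 1) by (unfold M; field; lra); lra. }
  set (t := T u) in *; destruct (HT u) as [Ht01 HTmin]; fold t in Ht01, HTmin.
  set (p := u -' seg a b t) in *.
  assert (Hpd : vnorm p < delta) by (apply Hclose; auto).
  assert (Hdistu : dist u = theta p) by reflexivity.
  (* Otherwise [u] is near [b], where [f] exceeds [fa + 2 * k], while [l] exceeds [l a] by at most
     [2 * k]; this contradicts [g u + Delta u <= g a]. *)
  assert (Ht1 : t < 1).
  { destruct (proj2 Ht01) as [H|H]; auto; exfalso.
    unfold p in Hpd; rewrite H, Hseg1 in Hpd.
    specialize (Hnearb u ltac:(lra)); rewrite Hfu in Hnearb; simpl in Hnearb.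
    pose proof (bounded_by_le _ _ (u -' b) Hlb) as H1.
    rewrite (linear_sub l) in H1, Hlk' by auto.
    pose proof (HDpos u); pose proof (HMd u).
    assert (A * vnorm (u -' b) <= k); [|lra].
    rewrite <- HAw; apply Rmult_le_compat_l; lra. }
  destruct (Hth p) as (G & HG & HGb & HGsub & HGsup).
  destruct (HDelta u) as (E & HE & HEb & _ & HEsup).
  (* As [t < 1], the parameter can be increased; since [t] is optimal, moving [p] by a small
     multiple of [a -' b] does not decrease [theta]. *)
  assert (HGba : G (b -' a) <= 0).
  { apply le_epsilon; intros e He; rewrite Rplus_0_l.
    destruct (HGsup (e / w)) as (d & Hd' & H); [apply Rdiv_lt_0_compat; auto|].
    set (s := Rmin (1 - t) (d / (2 * w))).
    assert (Hdw2 : 0 < d / (2 * w)) by (apply Rdiv_lt_0_compat; lra).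
    assert (Hs : 0 < s) by (apply Rmin_pos; lra).
    assert (Hs1 : s <= 1 - t) by apply Rmin_l.
    assert (Hs2 : s * w < d).
    { apply Rle_lt_trans with (d / (2 * w) * w); [apply Rmult_le_compat_r; [lra|apply Rmin_r]|].
      replace (d / (2 * w) * w) with (d / 2) by (field; lra); lra. }
    assert (Hn : vnorm ((- s) *' (b -' a)) = s * w).
    { rewrite vnorm_scal, Rabs_left by lra; fold w; ring. }
    specialize (H ((- s) *' (b -' a))); rewrite Hn, (proj2 HG) in H; specialize (H Hs2).
    specialize (HTmin (t + s) ltac:(lra)); fold p in HTmin.
    replace (u -' seg a b (t + s)) with (p +' (- s) *' (b -' a)) in HTmin by (unfold p, seg; vec).
    replace (e / w * (s * w)) with (e * s) in H by (field; lra).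
    apply Rmult_le_reg_l with s; auto; lra. }
  assert (HGp : 0 <= G p).
  { pose proof (HGsub (-' p)) as H; rewrite (linear_opp G) in H by auto.
    replace (p +' -' p) with (vzero : X) in H by vec; rewrite Hth0 in H.
    pose proof (Hthpos p); lra. }
  exists u, fu, (fun h => l h - M * G h - E h), t, (A + M + 2 * c).
  split; [split; [apply Ht01|auto]|split; [unfold p in *; lra|split; [|split; [lra|split]]]].
  - split; [|split; auto].
    + split; intros; rewrite ?(proj1 Hl), ?(proj1 HG), ?(proj1 HE),
        ?(proj2 Hl), ?(proj2 HG), ?(proj2 HE); ring.
    + intros e He.
      assert (He' : 0 < e / (M + 1)) by (apply Rdiv_lt_0_compat; lra).
      destruct (HGsup _ He') as (e1 & He1 & H1); destruct (HEsup _ He') as (e2 & He2 & H2).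
      exists (Rmin (Rmin e1 e2) (m0 / 4)); split; [repeat apply Rmin_pos; lra|].
      intros h r Hh Hr.
      assert (Hmins : vnorm h < e1 /\ vnorm h < e2 /\ vnorm h < m0 / 4).
      { revert Hh; unfold Rmin; repeat destruct Rle_dec; intros; repeat split; lra. }
      destruct Hmins as (Hh1 & Hh2 & Hh3).
      specialize (H1 h Hh1); specialize (H2 h Hh2).
      assert (Hdh : dom (u +' h)).
      { split; [|eauto]; pose proof (Hdist (u +' h) u) as H.
        replace (u +' h -' u) with h in H by vec; lra. }
      pose proof (Hmin _ Hdh) as Hmin'.
      unfold g at 2 in Hmin'; rewrite Hr in Hmin'; simpl in Hmin'.
      destruct (HT (u +' h)) as [_ H3]; specialize (H3 t Ht01).
      replace (u +' h -' seg a b t) with (p +' h) in H3 by (unfold p; vec).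
      fold (dist (u +' h)) in H3.
      rewrite Hgval, Hdistu, (proj1 Hl) in Hmin'.
      assert (H4 : M * dist (u +' h) <= M * (theta p + G h + e / (M + 1) * vnorm h)).
      { apply Rmult_le_compat_l; lra. }
      assert (H5 : e * vnorm h = M * (e / (M + 1) * vnorm h) + e / (M + 1) * vnorm h)
        by (field; lra).
      lra.
  - intros h; pose proof (bounded_by_le _ _ h Hlb); pose proof (bounded_by_le _ _ h HGb).
    pose proof (bounded_by_le _ _ h HEb); apply Rabs_le.
    assert (M * G h <= M * (1 * vnorm h)) by (apply Rmult_le_compat_l; lra).
    assert (M * - (1 * vnorm h) <= M * G h) by (apply Rmult_le_compat_l; lra).
    lra.
  (* The main term [(tau - t) * k] is at least [(tau - 1) * k]. By the choice of [delta] and [c],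
     [l p] and the gradient of [Delta] take at most a quarter of that each, and the penalty gradient
     contributes with the right sign. *)
  - replace (seg a b tau -' u) with ((tau - t) *' (b -' a) -' p) by (unfold p, seg; vec).
    rewrite (linear_sub l), (linear_sub G), (proj2 Hl), (proj2 HG) by auto; rewrite Hlk'.
    pose proof (bounded_by_le _ _ p Hlb) as H1.
    pose proof (bounded_by_le _ _ ((tau - t) *' (b -' a) -' p) HEb) as H2.
    assert (H3 : vnorm ((tau - t) *' (b -' a) -' p) <= tau * w + 1).
    { pose proof (vnorm_sub_le ((tau - t) *' (b -' a)) p) as H.
      rewrite vnorm_scal_nonneg in H by lra; fold w in H; nra. }
    assert (H4 : 2 * c * vnorm ((tau - t) *' (b -' a) -' p) <= (tau - 1) * k / 4).
    { apply Rle_trans with (2 * c * (tau * w + 1)); [apply Rmult_le_compat_l; lra|].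
      right; unfold c; field; lra. }
    assert (H5 : A * vnorm p <= (tau - 1) * k / 4).
    { apply Rle_trans with (A * ((tau - 1) * w / 4)); [apply Rmult_le_compat_l; lra|].
      right; rewrite <- HAw; field. }
    assert (H6 : (tau - t) * G (b -' a) <= 0) by nra.
    assert (H7 : M * ((tau - t) * G (b -' a) - G p) <= 0) by nra.
    assert (H8 : 0 <= (1 - t) * k) by nra.
    assert (H9 : 0 < (tau - 1) * k) by nra.
    lra.
Qed.

End MeanValue.

(** * Separable subspaces *)

(** Codes are lists of naturals, so the signed numerator is a difference of two of them. *)
Definition dyadic (p q k : nat) : R := (INR p - INR q) * (1 / 2) ^ k.

Lemma dyadic_dense c eps : 0 < eps -> exists p q k, Rabs (dyadic p q k - c) <= eps.
Proof.
  intros He; destruct (half_pow_small eps He) as [k Hk].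
  pose proof (half_pow_pos k) as Hp.
  set (s := c / (1 / 2) ^ k); destruct (archimed s) as [H1 H2].
  assert (Hz : exists p q, IZR (up s) = INR p - INR q).
  { destruct (Z.le_ge_cases 0 (up s)) as [H|H].
    - exists (Z.to_nat (up s)), O; rewrite INR_IZR_INZ, Z2Nat.id by lia; simpl; ring.
    - exists O, (Z.to_nat (- up s)); rewrite (INR_IZR_INZ (Z.to_nat _)), Z2Nat.id by lia.
      rewrite opp_IZR; simpl; ring. }
  destruct Hz as (p & q & Hz); exists p, q, k; unfold dyadic; rewrite <- Hz.
  replace c with (s * (1 / 2) ^ k) by (unfold s; field; lra).
  rewrite <- Rmult_minus_distr_r, Rabs_mult, (Rabs_pos_eq ((1 / 2) ^ k)), Rabs_pos_eq by lra.
  apply Rle_trans with (1 * (1 / 2) ^ k); [apply Rmult_le_compat_r; lra|lra].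
Qed.

(** The family is built in stages, each one enumerating the results of [op] on the previous stage
    together with copies of it. Two elements can thus be brought to a common stage, and the final
    sequence enumerates pairs of a stage and an index. *)
Lemma countable_closure {T : Type} (base : nat -> T) (op : list nat -> T -> T -> T) :
  exists d : nat -> T, (forall n, exists m, d m = base n) /\
    forall c i j, exists m, d m = op c (d i) (d j).
Proof.
  set (code := fun t : list nat * nat * nat => pickle t).
  set (decode := fun n => unpickle n : option (list nat * nat * nat)).
  assert (Hcode : forall t, decode (code t) = Some t) by exact (fun t => pickleK t).
  (* An empty list codes a copy from the previous stage; otherwise the head is a dummy and the tail
     is the parameter of [op]. *)
  set (st := fix st s n := match s with
    | O => base n
    | S s => match decode n with
             | Some (cons _ c, i, j) => op c (st s i) (st s j)
             | Some (nil, i, _) => st s i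
             | None => base O
             end
    end).
  assert (Hup : forall k s i, exists i', st (k + s)%nat i' = st s i).
  { induction k as [|k IH]; intros s i; [exists i; reflexivity|].
    destruct (IH s i) as [i' Hi']; exists (code (nil, i', O)).
    simpl; rewrite Hcode; exact Hi'. }
  exists (fun n => match decode n with Some (_, s, i) => st s i | None => base O end).
  split.
  - intros n; exists (code (nil, O, n)); rewrite Hcode; reflexivity.
  - intros c i j.
    assert (Hst : forall n, exists s k,
              match decode n with Some (_, s, i) => st s i | None => base O end = st s k).
    { intros n; destruct (decode n) as [[[l s] k]|]; [exists s, k|exists O, O]; reflexivity. }
    destruct (Hst i) as (s1 & k1 & H1); destruct (Hst j) as (s2 & k2 & H2); rewrite H1, H2.
    destruct (Hup s2 s1 k1) as [i1 E1]; destruct (Hup s1 s2 k2) as [i2 E2].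
    rewrite <- E1, <- E2, (Nat.add_comm s2 s1).
    exists (code (nil, S (s1 + s2), code (cons O c, i1, i2))); rewrite Hcode.
    simpl; rewrite Hcode; reflexivity.
Qed.

Definition closed_set {X : NormedSpace} (S : X -> Prop) : Prop :=
  forall x u, vlim x u -> (forall n, S (x n)) -> S u.

(** [S] is the closure of a sequence closed under addition, dyadic scaling and extraction of
    witnesses; density of the dyadic numbers gives all real scalars. The witnesses lie in [S] for
    base points of the sequence only, hence the later passage from [u] to a nearby [d n]. *)
Lemma separable_hull {X : NormedSpace} (a b : X) (W : list nat -> X -> list X) :
  exists (S : X -> Prop) (d : nat -> X),
    is_subspace S /\ closed_set S /\ S a /\ S b /\ (forall n, S (d n)) /\
    (forall x eps, S x -> 0 < eps -> exists n, vnorm (d n -' x) < eps) /\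
    forall c n x, In x (W c (d n)) -> S x.
Proof.
  (* Tag 1 is scaling by a dyadic number, tag 2 extracts a witness; anything else adds. *)
  set (op := fun c (x y : X) => match c with
    | cons (1%nat) (cons p (cons q (cons k nil))) => dyadic p q k *' x
    | cons (2%nat) (cons j c') => nth j (W c' x) vzero
    | _ => x +' y
    end).
  destruct (countable_closure (fun n => match n with O => a | _ => b end) op) as (d & Hbase & Hop).
  set (S := fun x => forall eps, 0 < eps -> exists n, vnorm (d n -' x) < eps).
  assert (Hd : forall n, S (d n)).
  { intros n eps He; exists n; rewrite vnorm_sub_self; auto. }
  assert (Hb : forall n, S (match n with O => a | _ => b end)).
  { intros n; destruct (Hbase n) as [m <-]; auto. }
  exists S, d; split; [split; [|split]|split; [|split; [apply (Hb O)|split; [apply (Hb 1%nat)|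
    split; [auto|split; [auto|]]]]]].
  - destruct (Hop (1 :: 0 :: 0 :: 0 :: nil)%nat O O) as [m Hm]; simpl in Hm.
    replace (dyadic 0 0 0 *' d O) with (vzero : X) in Hm; [rewrite <- Hm; auto|].
    replace (dyadic 0 0 0) with 0 by (unfold dyadic; simpl; ring); vec.
  - intros x y Hx Hy eps He.
    destruct (Hx (eps / 2)) as [i Hi]; [lra|]; destruct (Hy (eps / 2)) as [j Hj]; [lra|].
    destruct (Hop nil i j) as [m Hm]; exists m; rewrite Hm; simpl.
    replace (d i +' d j -' (x +' y)) with ((d i -' x) +' (d j -' y)) by vec.
    pose proof (vnorm_triangle X (d i -' x) (d j -' y)); lra.
  - intros r x Hx eps He.
    pose proof (vnorm_nonneg x) as Hx0; pose proof (Rabs_pos r) as Hr0.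
    set (e1 := Rmin 1 (eps / (2 * (vnorm x + 1)))).
    assert (He1 : 0 < e1) by (apply Rmin_pos; [lra|apply Rdiv_lt_0_compat; lra]).
    destruct (dyadic_dense r e1 He1) as (p & q & k & Hq); set (s := dyadic p q k) in *.
    destruct (Hx (eps / (2 * (Rabs r + 1)))) as [i Hi]; [apply Rdiv_lt_0_compat; lra|].
    destruct (Hop (1 :: p :: q :: k :: nil)%nat i O) as [m Hm]; exists m.
    rewrite Hm; simpl; fold s.
    replace (s *' d i -' r *' x) with (s *' (d i -' x) +' (s - r) *' x) by vec.
    pose proof (vnorm_triangle X (s *' (d i -' x)) ((s - r) *' x)) as H.
    rewrite !vnorm_scal in H.
    pose proof (Rmin_l 1 (eps / (2 * (vnorm x + 1)))) as M1.
    pose proof (Rmin_r 1 (eps / (2 * (vnorm x + 1)))) as M2; fold e1 in M1, M2.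
    assert (Hs : Rabs s <= Rabs r + 1).
    { replace s with (r + (s - r)) by ring; pose proof (Rabs_triang r (s - r)); lra. }
    assert (H1 : Rabs s * vnorm (d i -' x) <= (Rabs r + 1) * vnorm (d i -' x)).
    { apply Rmult_le_compat_r; [apply vnorm_nonneg|auto]. }
    assert (H2 : (Rabs r + 1) * vnorm (d i -' x) < eps / 2).
    { apply (Rmult_lt_compat_l (Rabs r + 1)) in Hi; [|lra].
      replace ((Rabs r + 1) * (eps / (2 * (Rabs r + 1)))) with (eps / 2) in Hi by (field; lra); auto. }
    assert (H3 : Rabs (s - r) * vnorm x <= eps / 2).
    { apply Rle_trans with (eps / (2 * (vnorm x + 1)) * (vnorm x + 1)).
      - pose proof (Rabs_pos (s - r)); apply Rmult_le_compat; lra.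
      - right; field; lra. }
    lra.
  - intros x u Hxu Hx eps He.
    destruct (Hxu (eps / 2)) as [N HN]; [lra|].
    destruct (Hx N (eps / 2)) as [n Hn]; [lra|]; exists n.
    specialize (HN N (Nat.le_refl N)); pose proof (vnorm_sub_triangle (d n) (x N) u); lra.
  - intros c n x Hx; destruct (In_nth _ _ vzero Hx) as (j & _ & Hj).
    destruct (Hop (2 :: j :: c)%nat n O) as [m Hm]; simpl in Hm.
    rewrite <- Hj, <- Hm; auto.
Qed.

Section Subspace.
Context {X : NormedSpace} (S : X -> Prop).
Hypothesis S_sub : is_subspace S.

Lemma subspace_opp x : S x -> S (-' x).
Proof. intros; rewrite vopp_scal; apply S_sub; auto. Qed.

Lemma sig_ext (x y : {z : X | S z}) : proj1_sig x = proj1_sig y -> x = y.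
Proof.
  destruct x as [x Hx], y as [y Hy]; simpl; intros; subst y; f_equal; apply proof_irrelevance.
Qed.

(** Transparent, so that later [change] steps can identify its operations with those of [X]. *)
Definition subspace : NormedSpace.
Proof.
  refine {| V := {x : X | S x};
    vzero := exist _ vzero (proj1 S_sub);
    vadd x y := exist _ (proj1_sig x +' proj1_sig y)
                  (proj1 (proj2 S_sub) _ _ (proj2_sig x) (proj2_sig y));
    vopp x := exist _ (-' proj1_sig x) (subspace_opp _ (proj2_sig x));
    vscal a x := exist _ (a *' proj1_sig x) (proj2 (proj2 S_sub) a _ (proj2_sig x));
    vnorm x := vnorm (proj1_sig x) |}; intros; try (apply sig_ext; simpl).
  - apply vadd_assoc.
  - apply vadd_comm.
  - apply vadd_zero.
  - apply vadd_opp.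
  - apply vscal_one.
  - apply vscal_assoc.
  - apply vscal_distr_l.
  - apply vscal_distr_r.
  - apply vnorm_eq0; auto.
  - apply vnorm_scal.
  - apply vnorm_triangle.
Defined.

(** The value 0 outside [S] is a placeholder: [is_dual_on] only looks at values on [S]. *)
Definition extend0 (g : subspace -> R) (x : X) : R :=
  match excluded_middle_informative (S x) with
  | left H => g (exist _ x H)
  | right _ => 0
  end.

Lemma extend0_val (g : subspace -> R) (y : subspace) : extend0 g (proj1_sig y) = g y.
Proof.
  unfold extend0; destruct (excluded_middle_informative _) as [H|H].
  - f_equal; apply sig_ext; reflexivity.
  - destruct H; exact (proj2_sig y).
Qed.

Lemma extend0_add (g : subspace -> R) x y : linear_form g -> S x -> S y ->
  extend0 g (x +' y) = extend0 g x + extend0 g y.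
Proof.
  intros Hg Hx Hy; pose (x' := exist _ x Hx : subspace); pose (y' := exist _ y Hy : subspace).
  change (extend0 g (proj1_sig (x' +' y')) = extend0 g (proj1_sig x') + extend0 g (proj1_sig y')).
  rewrite !extend0_val; apply Hg.
Qed.

Lemma extend0_scal (g : subspace -> R) a x : linear_form g -> S x ->
  extend0 g (a *' x) = a * extend0 g x.
Proof.
  intros Hg Hx; pose (x' := exist _ x Hx : subspace).
  change (extend0 g (proj1_sig (a *' x')) = a * extend0 g (proj1_sig x')).
  rewrite !extend0_val; apply Hg.
Qed.

Lemma extend0_bound (g : subspace -> R) M x : bounded_by M g -> S x ->
  Rabs (extend0 g x) <= M * vnorm x.
Proof.
  intros Hg Hx; pose (x' := exist _ x Hx : subspace).
  change (Rabs (extend0 g (proj1_sig x')) <= M * vnorm x'); rewrite extend0_val; apply Hg.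
Qed.

Lemma subspace_banach : Banach X -> closed_set S -> Banach subspace.
Proof.
  intros HX Hc u Hu; destruct (HX (fun n => proj1_sig (u n)) Hu) as [l Hl].
  assert (Sl : S l) by (apply (Hc (fun n => proj1_sig (u n))); [exact Hl|intros; apply proj2_sig]).
  exists (exist _ l Sl); exact Hl.
Qed.

Lemma subspace_separable_dual : separable_dual S ->
  exists gs : nat -> subspace -> R, (forall n, bounded_form (gs n)) /\
    forall g eps, linear_form g -> bounded_form g -> 0 < eps ->
      exists n, forall x, Rabs (g x - gs n x) <= eps * vnorm x.
Proof.
  intros (gs & Hgs & Hdense); exists (fun n y => gs n (proj1_sig y)); split.
  - intros n; destruct (Hgs n) as (_ & _ & M & HM).
    exists (Rmax M 0); split; [apply Rmax_r|].
    apply (bounded_by_weaken M); [apply Rmax_l|].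
    intros y; apply HM, (proj2_sig y).
  - intros g eps Hg (M & _ & HM) He; destruct (Hdense (extend0 g) eps) as [n Hn]; auto.
    + split; [intros; apply extend0_add; auto|split; [intros; apply extend0_scal; auto|]].
      exists M; intros; apply extend0_bound; auto.
    + exists n; intros y; rewrite <- (extend0_val g y); apply Hn, (proj2_sig y).
Qed.

End Subspace.

(** * Separable reduction *)

(* An item carries a sample point [pt] of the domain, the value [valr] of [f] there, a weight
   [wt], and the index [ord] of the slack [(1/2)^ord] allowed in the subgradient inequality. *)
Record item (X : NormedSpace) := Item { wt : R; ord : nat; pt : X; valr : R }.
Arguments Item {X} _ _ _ _.
Arguments wt {X} _.
Arguments ord {X} _.
Arguments pt {X} _.
Arguments valr {X} _.

Section Items.
Context {X : NormedSpace}.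
Implicit Types (l : list (item X)) (y : X).

(** [rad n] is the radius on which the inequality with slack [(1 / 2) ^ n] is claimed; [N] bounds
    the slacks in use, so that only finitely many radii have to be encoded. *)
Definition valid (f : X -> ER) y (N : nat) (rad : nat -> R) (i : item X) : Prop :=
  0 <= wt i /\ (ord i < N)%nat /\ f (pt i) = Fin (valr i) /\ vnorm (pt i -' y) < rad (ord i).

Fixpoint total l : R := match l with nil => 0 | i :: l => wt i + total l end.

(** The weighted sum of the upper bounds that the subgradient inequalities give for
    [xi (pt i -' y)], hence an upper bound for [xi (displ y l)]. *)
Fixpoint cost (c : R) y l : R :=
  match l with
  | nil => 0
  | i :: l => wt i * (valr i - c + (1 / 2) ^ ord i * vnorm (pt i -' y)) + cost c y l
  end.

Fixpoint displ y l : X :=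
  match l with nil => vzero | i :: l => wt i *' (pt i -' y) +' displ y l end.

Definition rescale (s : R) (i : item X) : item X := Item (s * wt i) (ord i) (pt i) (valr i).

Lemma cost_app c y l l' : cost c y (l ++ l') = cost c y l + cost c y l'.
Proof. induction l as [|i l IH]; simpl; [ring|rewrite IH; ring]. Qed.

Lemma displ_app y l l' : displ y (l ++ l') = displ y l +' displ y l'.
Proof. induction l as [|i l IH]; simpl; [vec|rewrite IH; vec]. Qed.

Lemma total_rescale s l : total (map (rescale s) l) = s * total l.
Proof. induction l as [|i l IH]; simpl; [ring|rewrite IH; ring]. Qed.

Lemma cost_rescale s c y l : cost c y (map (rescale s) l) = s * cost c y l.
Proof. induction l as [|i l IH]; simpl; [ring|rewrite IH; ring]. Qed.

Lemma displ_rescale s y l : displ y (map (rescale s) l) = s *' displ y l.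
Proof. induction l as [|i l IH]; simpl; [vec|rewrite IH; vec]. Qed.

Lemma valid_rescale f y N rad s l : 0 <= s ->
  List.Forall (valid f y N rad) l -> List.Forall (valid f y N rad) (map (rescale s) l).
Proof.
  intros Hs H; induction H as [|i l (Hi & Hi') H IH]; simpl; constructor; auto.
  split; [simpl; apply Rmult_le_pos; auto|exact Hi'].
Qed.

Lemma total_nonneg f y N rad l : List.Forall (valid f y N rad) l -> 0 <= total l.
Proof. intros H; induction H as [|i l (Hi & _) H IH]; simpl; lra. Qed.

(* A finite certificate that no functional bounded by [K], with value at least [kap] at [d - y],
   can satisfy the approximate subgradient inequalities at [y] with [c] in place of [f y]. *)
Definition obstruction (f : X -> ER) (d : X) (N : nat) (K kap : R)
  (y : X) (rad : nat -> R) (c gam : R) (l : list (item X)) (mu : R) : Prop :=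
  List.Forall (valid f y N rad) l /\ 0 <= mu /\ total l + mu <= 1 /\
  cost c y l + K * vnorm (displ y l -' mu *' (d -' y)) - mu * kap <= - gam.

Lemma displ_recenter y y' l : displ y' l = displ y l +' total l *' (y -' y').
Proof. induction l as [|i l IH]; simpl; [vec|rewrite IH; vec]. Qed.

Lemma cost_recenter f N rad y y' c c' l : List.Forall (valid f y N rad) l ->
  cost c' y' l <= cost c y l + total l * (Rabs (c - c') + vnorm (y -' y')).
Proof.
  intros H; induction H as [|i l (Hw & _) H IH]; simpl; [lra|].
  assert (wt i * (valr i - c' + (1 / 2) ^ ord i * vnorm (pt i -' y'))
          <= wt i * (valr i - c + (1 / 2) ^ ord i * vnorm (pt i -' y))
             + wt i * (Rabs (c - c') + vnorm (y -' y'))); [|lra].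
  rewrite <- Rmult_plus_distr_l; apply Rmult_le_compat_l; auto.
  pose proof (Rle_abs (c - c')); pose proof (vnorm_sub_triangle (pt i) y y') as Ht.
  pose proof (half_pow_pos (ord i)); pose proof (half_pow_antitone O (ord i) ltac:(lia)) as Hp.
  simpl in Hp; pose proof (vnorm_nonneg (y -' y')).
  apply (Rmult_le_compat_l ((1 / 2) ^ ord i)) in Ht; [|lra]; nra.
Qed.

(** As the weights amount to at most 1, moving the base point and changing [c] costs at most
    [Rabs (c - c')] plus [1 + K] times the displacement. It is used twice: from [u] to a dense
    point, and back with the witnesses found there. *)
Lemma obstruction_recenter f d N K kap y y' rad rad' c c' gam gam' l mu : 0 <= K ->
  obstruction f d N K kap y rad c gam l mu ->
  (forall n, (n < N)%nat -> rad n + vnorm (y -' y') <= rad' n) ->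
  gam' + Rabs (c - c') + (1 + K) * vnorm (y -' y') <= gam ->
  obstruction f d N K kap y' rad' c' gam' l mu.
Proof.
  intros HK (Hl & Hmu & Htot & Hc) Hrad Hgam.
  pose proof (total_nonneg _ _ _ _ _ Hl) as Ht0.
  split; [|split; [auto|split; [auto|]]].
  - clear Htot Hc Ht0; induction Hl as [|i l (Hw & Hn & Hf & Hr) Hl IH]; constructor; auto.
    split; [auto|split; [auto|split; [auto|]]].
    pose proof (vnorm_sub_triangle (pt i) y y'); pose proof (Hrad _ Hn); lra.
  - pose proof (cost_recenter f N rad y y' c c' l Hl) as H1.
    set (e := vnorm (y -' y')) in *; pose proof (vnorm_nonneg (y -' y')) as He; fold e in He.
    assert (H2 : vnorm (displ y' l -' mu *' (d -' y'))
                 <= vnorm (displ y l -' mu *' (d -' y)) + e).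
    { rewrite (displ_recenter y y').
      replace (displ y l +' total l *' (y -' y') -' mu *' (d -' y'))
        with ((displ y l -' mu *' (d -' y)) +' (total l - mu) *' (y -' y')) by vec.
      eapply Rle_trans; [apply vnorm_triangle|]; apply Rplus_le_compat_l.
      rewrite vnorm_scal; fold e.
      assert (Rabs (total l - mu) <= 1) by (apply Rabs_le; lra); nra. }
    apply (Rmult_le_compat_l K) in H2; auto.
    pose proof (Rabs_pos (c - c')).
    assert (total l * (Rabs (c - c') + e) <= 1 * (Rabs (c - c') + e))
      by (apply Rmult_le_compat_r; lra).
    lra.
Qed.

(** The violated inequality is homogeneous in the weights and [mu]; dividing by their sum plus 1
    normalizes it. *)
Lemma obstruction_normalize f d N K kap y rad c l mu : 0 <= K ->
  List.Forall (valid f y N rad) l -> 0 <= mu ->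
  cost c y l + K * vnorm (displ y l -' mu *' (d -' y)) - mu * kap < 0 ->
  exists gam l' mu', 0 < gam /\ obstruction f d N K kap y rad c gam l' mu'.
Proof.
  intros HK Hl Hmu Hneg; pose proof (total_nonneg _ _ _ _ _ Hl) as Ht.
  set (v := cost c y l + K * vnorm (displ y l -' mu *' (d -' y)) - mu * kap) in *.
  set (s := / (total l + mu + 1)).
  assert (Hs : 0 < s) by (apply Rinv_0_lt_compat; lra).
  assert (Hs1 : s * (total l + mu + 1) = 1) by (unfold s; field; lra).
  exists (s * - v), (map (rescale s) l), (s * mu).
  split; [nra|split; [apply valid_rescale; [lra|auto]|split; [nra|split]]].
  - rewrite total_rescale; nra.
  - rewrite cost_rescale, displ_rescale.
    replace (s *' displ y l -' (s * mu) *' (d -' y))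
      with (s *' (displ y l -' mu *' (d -' y))) by vec.
    rewrite vnorm_scal_nonneg by lra; unfold v; right; ring.
Qed.

(** Adding the subgradient inequalities gives [g (displ y l) <= cost c y l]; with the bound [K] on
    the remainder and [kap] on [d -' y], the quantity in the certificate is nonnegative. *)
Lemma no_obstruction_of_subgradient (S : X -> Prop) (g : X -> R) f d N K kap y rad c gam l mu :
  is_subspace S -> S y -> S d ->
  (forall x z, S x -> S z -> g (x +' z) = g x + g z) ->
  (forall a x, S x -> g (a *' x) = a * g x) ->
  (forall x, S x -> Rabs (g x) <= K * vnorm x) ->
  (forall n x r, (n < N)%nat -> S x -> f x = Fin r -> vnorm (x -' y) < rad n ->
     c + g (x -' y) - (1 / 2) ^ n * vnorm (x -' y) <= r) ->
  kap <= g (d -' y) -> 0 < gam ->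
  (forall i, In i l -> S (pt i)) -> ~ obstruction f d N K kap y rad c gam l mu.
Proof.
  intros HS Hy Hd Hadd Hscal HK Hsub Hkap Hgam Hpts (Hl & Hmu & _ & Hc).
  assert (Hdiff : forall x z, S x -> S z -> S (x -' z)).
  { intros x z Hx Hz; unfold vsub; rewrite vopp_scal; apply HS; auto; apply HS; auto. }
  assert (Hmain : S (displ y l) /\ g (displ y l) <= cost c y l).
  { clear Hc; induction Hl as [|i l (Hw & Hn & Hf & Hr) Hl IH]; simpl.
    - split; [apply HS|]; rewrite <- (vscal_zero_l vzero), Hscal by apply HS; lra.
    - destruct IH as [IH1 IH2]; [intros j Hj; apply Hpts; right; auto|].
      assert (Hi : S (pt i)) by (apply Hpts; left; auto).
      assert (Hiy : S (pt i -' y)) by auto.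
      assert (Hwi : S (wt i *' (pt i -' y))) by (apply HS; auto).
      split; [apply HS; auto|].
      rewrite Hadd, Hscal by auto.
      pose proof (Hsub _ _ _ Hn Hi Hf Hr).
      assert (wt i * g (pt i -' y)
              <= wt i * (valr i - c + (1 / 2) ^ ord i * vnorm (pt i -' y))); [|lra].
      apply Rmult_le_compat_l; auto; lra. }
  destruct Hmain as [HSl Hle].
  assert (HSmu : S (mu *' (d -' y))) by (apply HS; auto).
  pose proof (HK _ (Hdiff _ _ HSl HSmu)) as H1; apply Rabs_le_between in H1.
  assert (H2 : g (displ y l) = g (displ y l -' mu *' (d -' y)) + mu * g (d -' y)).
  { rewrite <- Hscal, <- Hadd by auto; f_equal; vec. }
  assert (mu * kap <= mu * g (d -' y)) by (apply Rmult_le_compat_l; auto).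
  lra.
Qed.

(** The converse, by [hahn_banach]: the constraints are the cone generated by the subgradient
    inequalities, the bound [K] and the lower bound at [d -' u], and their consistency at the origin
    is the last hypothesis. *)
Lemma subgradient_of_no_obstruction (f : X -> ER) (d u : X) (fu K kap : R) (rad : nat -> R) :
  0 <= K -> f u = Fin fu -> (forall n, 0 < rad n) ->
  (forall N l mu, List.Forall (valid f u N rad) l -> 0 <= mu ->
     0 <= cost fu u l + K * vnorm (displ u l -' mu *' (d -' u)) - mu * kap) ->
  exists xi, frechet_at f u fu xi /\ bounded_by K xi /\ kap <= xi (d -' u).
Proof.
  intros HK Hfu Hrad Hno.
  destruct (hahn_banach (fun h s => exists N l mu, List.Forall (valid f u N rad) l /\ 0 <= mu /\
      cost fu u l - mu * kap + K * vnorm (h -' displ u l +' mu *' (d -' u)) <= s))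
    as (xi & Hxi & HQ).
  - intros h1 h2 s1 s2 (N1 & l1 & mu1 & Hl1 & Hm1 & H1) (N2 & l2 & mu2 & Hl2 & Hm2 & H2).
    exists (max N1 N2), (l1 ++ l2), (mu1 + mu2); split; [|split; [lra|]].
    + apply Forall_app; split; [revert Hl1|revert Hl2]; apply Forall_impl;
        intros i (Hw & Hn & Hi); split; auto; split; auto; lia.
    + rewrite cost_app, displ_app.
      replace (h1 +' h2 -' (displ u l1 +' displ u l2) +' (mu1 + mu2) *' (d -' u))
        with ((h1 -' displ u l1 +' mu1 *' (d -' u)) +' (h2 -' displ u l2 +' mu2 *' (d -' u)))
        by vec.
      pose proof (vnorm_triangle X (h1 -' displ u l1 +' mu1 *' (d -' u))
                    (h2 -' displ u l2 +' mu2 *' (d -' u))) as Ht.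
      apply (Rmult_le_compat_l K) in Ht; auto; lra.
  - intros t h s Ht (N & l & mu & Hl & Hm & H).
    exists N, (map (rescale t) l), (t * mu).
    split; [apply valid_rescale; [lra|auto]|split; [nra|]].
    rewrite cost_rescale, displ_rescale.
    replace (t *' h -' t *' displ u l +' (t * mu) *' (d -' u))
      with (t *' (h -' displ u l +' mu *' (d -' u))) by vec.
    rewrite vnorm_scal_nonneg by lra; nra.
  - intros h; eexists; exists O, nil, 0; split; [constructor|split; [lra|apply Rle_refl]].
  - intros s (N & l & mu & Hl & Hm & H).
    specialize (Hno N l mu Hl Hm).
    replace (vzero -' displ u l +' mu *' (d -' u))
      with (-' (displ u l -' mu *' (d -' u))) in H by vec.
    rewrite vnorm_opp in H; lra.
  - exists xi; split; [split; [auto|split; [auto|]]|split].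
    + intros eps He; destruct (half_pow_small eps He) as [n Hn].
      exists (rad n); split; auto; intros h r Hh Hr.
      assert (Hle : xi h <= r - fu + (1 / 2) ^ n * vnorm h).
      { apply HQ; exists (S n), (Item 1 n (u +' h) r :: nil), 0.
        split; [|split; [lra|simpl]].
        - constructor; [|constructor]; split; [simpl; lra|split; [simpl; lia|split; [auto|]]].
          simpl; replace (u +' h -' u) with h by vec; auto.
        - replace (u +' h -' u) with h by vec.
          replace (h -' (1 *' h +' vzero) +' 0 *' (d -' u)) with (vzero : X) by vec.
          rewrite vnorm_vzero; lra. }
      pose proof (vnorm_nonneg h).
      assert ((1 / 2) ^ n * vnorm h <= eps * vnorm h) by (apply Rmult_le_compat_r; lra); lra.
    + apply linear_bounded_of_le; auto; intros h; apply HQ; exists O, nil, 0.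
      split; [constructor|split; [lra|simpl]].
      replace (h -' vzero +' 0 *' (d -' u)) with h by vec; lra.
    + assert (Hle : xi (-' (d -' u)) <= - kap).
      { apply HQ; exists O, nil, 1; split; [constructor|split; [lra|simpl]].
        replace (-' (d -' u) -' vzero +' 1 *' (d -' u)) with (vzero : X) by vec.
        rewrite vnorm_vzero; lra. }
      rewrite (linear_opp xi) in Hle by auto; lra.
Qed.

End Items.

Lemma lsc_subspace {X : NormedSpace} (S : X -> Prop) (HS : is_subspace S) (f : X -> ER) :
  lsc f -> lsc (fun y : subspace S HS => f (proj1_sig y)).
Proof.
  intros H x r Hr; destruct (H _ _ Hr) as (e & He & Hb); exists e; split; auto.
Qed.

(* A subgradient found in a separable subspace extends: the subspace was chosen to contain
   (approximately) every finite obstruction based at one of its points. *)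
Lemma mean_value {X : NormedSpace} (f : X -> ER) (a b : X) (fa tau eps : R) :
  Asplund X -> lsc f -> f a = Fin fa -> R_lt_ER fa (f b) -> 1 < tau -> 0 < eps ->
  exists u fu xi t, 0 <= t < 1 /\ vnorm (u -' seg a b t) < eps /\
    frechet_at f u fu xi /\ bounded_form xi /\ 0 < xi (seg a b tau -' u).
Proof.
  intros [HX Hsep] Hlsc Hfa Hfb Htau Heps.
  set (d := seg a b tau).
  (* [code] lists [N], [K], the exponent of [kap], a dyadic approximation of the value at the
     base point, the exponent of the gap, and the exponents of the radii. *)
  set (prob := fun (code : list nat) (y : X) (l : list (item X)) => exists mu,
    obstruction f d (nth 0 code O) (INR (nth 1 code O)) ((1 / 2) ^ nth 2 code O) y
      (fun n => 3 / 2 * (1 / 2) ^ nth (7 + n) code O)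
      (dyadic (nth 3 code O) (nth 4 code O) (nth 5 code O)) ((1 / 2) ^ nth 6 code O) l mu).
  destruct (choice (fun (cy : list nat * X) l =>
      (exists l', prob (fst cy) (snd cy) l') -> prob (fst cy) (snd cy) l)) as [W HW].
  { intros [c y]; simpl; destruct (classic (exists l', prob c y l')) as [[l Hl]|Hn].
    - exists l; auto.
    - exists nil; intros H; destruct (Hn H). }
  destruct (separable_hull a b (fun c y => map pt (W (c, y))))
    as (S & e & HS & Hcl & Sa & Sb & Se & Hdense & HWS).
  set (Y := subspace S HS).
  destruct (subspace_separable_dual S HS) as (gs & Hgs & Hgd).
  { apply Hsep; auto; exists e; auto. }
  destruct (mean_value_separable (X := Y) gs (subspace_banach S HS HX Hcl) Hgs Hgd
      (fun y => f (proj1_sig y)) (exist _ a Sa) (exist _ b Sb) fa tau eps)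
    as (u & fu & xi & t & K & Ht & Hu & (Hxi & Hfu & Hsub) & HK0 & HK & Hpos); auto.
  { apply lsc_subspace; auto. }
  set (u' := proj1_sig u : X) in *; change (f u' = Fin fu) in Hfu.
  assert (Su : S u') by apply proj2_sig.
  assert (Sd : S d).
  { unfold d, seg, vsub; rewrite vopp_scal; apply HS; auto; apply HS, HS; auto; apply HS; auto. }
  set (g := extend0 S HS xi).
  assert (Hgd' : 0 < g (d -' u')).
  { change (0 < extend0 S HS xi (proj1_sig (seg (exist _ a Sa : Y) (exist _ b Sb : Y) tau -' u))).
    rewrite extend0_val; exact Hpos. }
  (* The strict sign and the bound [K] are rounded to [(1 / 2) ^ jk] and [INR Kn], so that both fit
     into a code. *)
  destruct (half_pow_small _ Hgd') as [jk Hjk].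
  destruct (INR_unbounded K) as [Kn HKn].
  (* The inequality holds up to twice the radius [(1 / 2) ^ k]. Certificates use radius factor 1 at
     [u'], 3/2 at the dense point and 2 back at [u'], which leaves room for both moves. *)
  destruct (choice (fun n k => forall x r, S x -> f x = Fin r -> vnorm (x -' u') < 2 * (1 / 2) ^ k ->
              fu + g (x -' u') - (1 / 2) ^ n * vnorm (x -' u') <= r)) as [ks Hks].
  { intros n; destruct (Hsub _ (half_pow_pos n)) as (del & Hdel & H).
    destruct (half_pow_small (del / 2)) as [k Hk]; [lra|]; exists k; intros x r Sx Hx Hxu.
    set (x' := exist _ x Sx : Y); specialize (H (x' -' u) r).
    change (g (x -' u')) with (extend0 S HS xi (proj1_sig (x' -' u))).
    change (vnorm (x -' u')) with (vnorm (x' -' u)); change (vnorm (x -' u')) with (vnorm (x' -' u)) in Hxu.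
    rewrite extend0_val; apply H; [lra|].
    replace (u +' (x' -' u)) with x' by vec; exact Hx. }
  assert (HgK : forall x, S x -> Rabs (g x) <= INR Kn * vnorm x).
  { intros x Sx; apply extend0_bound; auto; apply (bounded_by_weaken K); [lra|auto]. }
  destruct (subgradient_of_no_obstruction f d u' fu (INR Kn) ((1 / 2) ^ jk)
      (fun n => (1 / 2) ^ ks n)) as (xi' & Hxi' & Hb & Hd).
  - apply pos_INR.
  - exact Hfu.
  - intros; apply half_pow_pos.
  - intros N l mu Hl Hmu; apply Rnot_lt_le; intros Hneg.
    destruct (obstruction_normalize f d N (INR Kn) ((1 / 2) ^ jk) u' (fun n => (1 / 2) ^ ks n) fu l mu)
      as (gam & l1 & mu1 & Hgam & Hob); auto using pos_INR.
    destruct (half_pow_small (gam / 2)) as [jg Hjg]; [lra|].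
    pose proof (half_pow_pos jg) as Hjg0.
    (* [eta] is at most half of every radius in use, and with the rounding of [fu] each move costs
       at most [(1 / 2) ^ jg / 2]: the gap goes from [gam > 2 * (1 / 2) ^ jg] to [(1 / 2) ^ jg] and
       then to a quarter of it. *)
    assert (Heta : exists eta, 0 < eta /\ (1 + INR Kn) * eta <= (1 / 2) ^ jg / 4 /\
              forall n, (n < N)%nat -> eta <= / 2 * (1 / 2) ^ ks n).
    { clear - Hjg0; pose proof (pos_INR Kn) as HKn; induction N as [|N (eta & H0 & H1 & H2)].
      - exists ((1 / 2) ^ jg / 4 / (1 + INR Kn)); split; [|split; [|intros; lia]].
        + repeat apply Rdiv_lt_0_compat; lra.
        + right; field; lra.
      - pose proof (half_pow_pos (ks N)).
        exists (Rmin eta (/ 2 * (1 / 2) ^ ks N)); split; [apply Rmin_pos; lra|split].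
        + eapply Rle_trans; [|exact H1]; apply Rmult_le_compat_l; [lra|apply Rmin_l].
        + intros n Hn; destruct (Nat.eq_dec n N) as [->|]; [apply Rmin_r|].
          eapply Rle_trans; [apply Rmin_l|apply H2; lia]. }
    destruct Heta as (eta & Heta0 & Heta1 & Heta2).
    destruct (Hdense u' eta Su Heta0) as [i Hi].
    destruct (dyadic_dense fu ((1 / 2) ^ jg / 4)) as (p & q & k & Hpq); [lra|].
    set (code := (N :: Kn :: jk :: p :: q :: k :: jg :: map ks (seq 0 N))%nat).
    assert (Hcode : forall n, (n < N)%nat -> nth (7 + n) code O = ks n).
    { intros n Hn; simpl; rewrite nth_indep with (d' := ks O) by (rewrite length_map, length_seq; lia).
      rewrite map_nth, seq_nth by lia; reflexivity. }
    assert (Hen : (1 + INR Kn) * vnorm (e i -' u') <= (1 / 2) ^ jg / 4).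
    { eapply Rle_trans; [|exact Heta1]; pose proof (pos_INR Kn); apply Rmult_le_compat_l; lra. }
    assert (Hprob : prob code (e i) (W (code, e i))).
    { apply (HW (code, e i)); change (exists l', prob code (e i) l'); exists l1, mu1.
      apply (obstruction_recenter _ _ _ _ _ u' _ (fun n => (1 / 2) ^ ks n) _ fu _ gam); auto using pos_INR.
      - intros n Hn; change (nth 0 code O) with N in Hn; rewrite Hcode by auto.
        specialize (Heta2 n Hn); rewrite vnorm_sub_sym; lra.
      - change (dyadic (nth 3 code O) (nth 4 code O) (nth 5 code O)) with (dyadic p q k).
        change (nth 6 code O) with jg; change (nth 1 code O) with Kn.
        rewrite Rabs_minus_sym in Hpq; rewrite (vnorm_sub_sym u'); lra. }
    destruct Hprob as [mu2 Hob2].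
    (* The selected witnesses lie in [S], where [g] is a genuine subgradient. *)
    apply (no_obstruction_of_subgradient S g f d N (INR Kn) ((1 / 2) ^ jk) u'
             (fun n => 2 * (1 / 2) ^ ks n) fu ((1 / 2) ^ jg / 4) (W (code, e i)) mu2); auto.
    + intros; apply extend0_add; auto.
    + intros; apply extend0_scal; auto.
    + lra.
    + lra.
    + intros it Hit; apply (HWS code i); apply in_map; auto.
    + apply (obstruction_recenter _ _ _ _ _ _ _ _ _ _ _ _ _ _ _ (pos_INR _) Hob2).
      * intros n Hn; change (nth 0 code O) with N in Hn; rewrite Hcode by auto.
        specialize (Heta2 n Hn); lra.
      * change (dyadic (nth 3 code O) (nth 4 code O) (nth 5 code O)) with (dyadic p q k).
        change (nth 6 code O) with jg; change (nth 1 code O) with Kn; lra.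
  - exists u', fu, xi', t; split; [auto|split; [exact Hu|split; [auto|split]]].
    + exists (INR Kn); split; [apply pos_INR|auto].
    + pose proof (half_pow_pos jk); lra.
Qed.

(** * Robust quasiconvexity *)

Lemma frechet_subdiff_of_at {X : NormedSpace} (f : X -> ER) u fu xi :
  frechet_at f u fu xi -> bounded_form xi -> frechet_subdiff f u xi.
Proof.
  intros (Hxi & Hfu & Hsub) Hb; split; [apply is_dual_iff; auto|].
  exists fu; split; auto; intros eps He; destruct (Hsub eps He) as (del & Hdel & H).
  exists del; split; auto; intros y [Hy0 Hy]; destruct (f y) as [fy|] eqn:Hfy; auto.
  specialize (H (y -' u) fy Hy); replace (u +' (y -' u)) with y in H by vec; specialize (H Hfy).
  apply Rmult_le_reg_r with (vnorm (y -' u)); auto.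
  replace ((fy - fu - xi (y -' u)) / vnorm (y -' u) * vnorm (y -' u))
    with (fy - fu - xi (y -' u)) by (field; lra); lra.
Qed.

Lemma frechet_at_untilt {X : NormedSpace} (f : X -> ER) (v : X -> R) u pu xi :
  linear_form v -> frechet_at (tilt f v) u pu xi ->
  frechet_at f u (pu - v u) (fun h => xi h - v h).
Proof.
  intros Hv (Hxi & Hfu & Hsub); split; [|split].
  - split; intros; rewrite ?(proj1 Hxi), ?(proj1 Hv), ?(proj2 Hxi), ?(proj2 Hv); ring.
  - unfold tilt in Hfu; destruct (f u); simpl in Hfu; inversion Hfu; f_equal; ring.
  - intros eps He; destruct (Hsub eps He) as (del & Hdel & H); exists del; split; auto.
    intros h r Hh Hr; specialize (H h (r + v (u +' h)) Hh).
    unfold tilt in H; rewrite Hr in H; specialize (H eq_refl).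
    rewrite (proj1 Hv) in H; lra.
Qed.

Lemma lsc_tilt {X : NormedSpace} (f : X -> ER) (v : X -> R) :
  lsc f -> linear_form v -> bounded_form v -> lsc (tilt f v).
Proof.
  intros Hf Hv (K & HK & Hb) x r Hr.
  assert (Hg : exists gam, 0 < gam /\ R_lt_ER (r - v x + gam) (f x)).
  { unfold tilt in Hr; destruct (f x) as [fx|]; simpl in *.
    - exists ((fx + v x - r) / 2); lra.
    - exists 1; split; [lra|exact I]. }
  destruct Hg as (gam & Hgam & Hg); destruct (Hf _ _ Hg) as (del & Hdel & H).
  exists (Rmin del (gam / (K + 1))); split; [apply Rmin_pos; auto; apply Rdiv_lt_0_compat; lra|].
  intros y Hy; specialize (H y (Rlt_le_trans _ _ _ Hy (Rmin_l _ _))).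
  assert (Hy2 : vnorm (y -' x) < gam / (K + 1)) by (eapply Rlt_le_trans; [exact Hy|apply Rmin_r]).
  pose proof (bounded_by_le _ _ (y -' x) Hb) as Hvy; rewrite (linear_sub v) in Hvy by auto.
  assert (Hc : K * vnorm (y -' x) <= gam).
  { pose proof (vnorm_nonneg (y -' x)); apply Rle_trans with ((K + 1) * (gam / (K + 1))).
    - apply Rmult_le_compat; lra.
    - right; field; lra. }
  unfold tilt; destruct (f y); simpl in *; auto; lra.
Qed.

Section RobustQuasiconvexity.
Context {X : NormedSpace}.
Implicit Types (x y z u w : X).

Lemma condition_b_of_robust (phi : X -> ER) alpha : 0 < alpha ->
  robustly_quasiconvex alpha phi -> condition_b alpha phi.
Proof.
  intros Ha Hrob x y fx fy Hx Hy Hle xs (Hdual & fx' & Hx' & Hsub).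
  rewrite Hx in Hx'; injection Hx' as <-.
  apply is_dual_iff in Hdual; destruct Hdual as [Hxs _].
  set (e := y -' x); pose proof (vnorm_nonneg e) as He0.
  destruct (Req_dec (vnorm e) 0) as [He|He].
  { assert (y = x) by (apply vsub_eq0; exact He); subst y.
    rewrite Hx in Hy; injection Hy as <-.
    unfold e; rewrite (linear_sub xs), vnorm_sub_self by auto.
    unfold Rmin; destruct Rle_dec; lra. }
  set (m := Rmin (alpha * vnorm e) (fx - fy)).
  assert (Hm0 : 0 <= m) by (apply Rmin_glb; nra).
  assert (Hm1 : m <= alpha * vnorm e) by apply Rmin_l.
  assert (Hm2 : m <= fx - fy) by apply Rmin_r.
  assert (Hme : m / vnorm e * vnorm e = m) by (field; auto).
  assert (Hma : m / vnorm e <= alpha).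
  { apply Rmult_le_reg_r with (vnorm e); lra. }
  destruct (norming_functional (m / vnorm e) m e) as (v & Hv & Hvb & Hve).
  { apply Rmult_le_pos; auto; apply Rlt_le, Rinv_0_lt_compat; lra. }
  { lra. }
  assert (Hve' : v e = m) by (pose proof (bounded_by_le _ _ e Hvb); lra).
  assert (Hqc : quasiconvex (tilt phi v)).
  { apply Hrob.
    - apply is_dual_iff; split; auto; exists alpha; split; [lra|].
      apply (bounded_by_weaken (m / vnorm e)); auto.
    - apply (bounded_by_weaken (m / vnorm e)); auto. }
  apply le_epsilon; intros eps Heps.
  destruct (Hsub (eps / vnorm e)) as (del & Hdel & H); [apply Rdiv_lt_0_compat; lra|].
  set (lam := Rmin (1 / 2) (del / (2 * vnorm e))).
  assert (Hdv : 0 < del / (2 * vnorm e)) by (apply Rdiv_lt_0_compat; lra).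
  assert (Hlam : 0 < lam) by (apply Rmin_pos; lra).
  assert (Hlam1 : lam <= 1 / 2) by apply Rmin_l.
  assert (Hlam2 : lam * vnorm e <= del / 2).
  { apply Rle_trans with (del / (2 * vnorm e) * vnorm e).
    - apply Rmult_le_compat_r; [lra|apply Rmin_r].
    - right; field; auto. }
  specialize (H (x +' lam *' e)).
  replace (x +' lam *' e -' x) with (lam *' e) in H by vec.
  rewrite vnorm_scal_nonneg in H by lra.
  assert (Hr : 0 < lam * vnorm e < del) by nra.
  specialize (H Hr).
  pose proof (Hqc y x lam ltac:(lra)) as Hq.
  replace (lam *' y +' (1 - lam) *' x) with (x +' lam *' e) in Hq by (unfold e; vec).
  unfold tilt in Hq; rewrite Hx, Hy in Hq; simpl in Hq.
  destruct (phi (x +' lam *' e)) as [r|]; simpl in Hq; [|contradiction].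
  rewrite (proj1 Hv), (proj2 Hv), (proj2 Hxs) in *.
  assert (Hvy : v y = v x + m) by (rewrite <- Hve'; unfold e; rewrite (linear_sub v) by auto; ring).
  (* Since [m <= fx - fy], the tilted value at [y] does not exceed the one at [x]. *)
  rewrite Rmax_right in Hq by lra.
  apply (Rmult_le_compat_r (lam * vnorm e)) in H; [|lra].
  replace ((r - fx - lam * xs e) / (lam * vnorm e) * (lam * vnorm e))
    with (r - fx - lam * xs e) in H by (field; split; lra).
  replace (- (eps / vnorm e) * (lam * vnorm e)) with (- (eps * lam)) in H by (field; auto).
  apply Rmult_le_reg_l with lam; auto; rewrite Hve' in Hq; lra.
Qed.

(** [xi - v] is a subgradient of [phi], so [xi (w -' u)] is at most [v (w -' u)] minus the minimum
    in (b). If the minimum is the norm term, it absorbs [v] by [bounded_by alpha v]; if it is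
    [fu - fw], by the comparison of tilted values. *)
Lemma condition_b_tilt (phi : X -> ER) alpha (v : X -> R) u w fu fw xi :
  condition_b alpha phi -> linear_form v -> bounded_by alpha v ->
  frechet_at (tilt phi v) u (fu + v u) xi -> bounded_form xi -> bounded_form v ->
  phi w = Fin fw -> fw <= fu -> fw + v w <= fu + v u -> xi (w -' u) <= 0.
Proof.
  intros Hb Hv Hva Hat Hxib Hvb Hw Hle Hle'.
  apply frechet_at_untilt in Hat; auto.
  replace (fu + v u - v u) with fu in Hat by ring.
  pose proof (Hb u w fu fw (proj1 (proj2 Hat)) Hw Hle _
    (frechet_subdiff_of_at _ _ _ _ Hat (bounded_form_sub _ _ Hxib Hvb))) as H.
  pose proof (bounded_by_le _ _ (w -' u) Hva) as Hvw.
  revert H; unfold Rmin; destruct Rle_dec; intros H; [lra|].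
  rewrite (linear_sub v) in *; auto; lra.
Qed.

Lemma not_quasiconvex (f : X -> ER) : ~ quasiconvex f ->
  exists x y lam fx fy, 0 < lam < 1 /\ f x = Fin fx /\ f y = Fin fy /\
    R_lt_ER fx (f (lam *' x +' (1 - lam) *' y)) /\ R_lt_ER fy (f (lam *' x +' (1 - lam) *' y)).
Proof.
  intros Hn; apply NNPP; intros Hno; apply Hn; intros x y lam Hlam; apply NNPP; intros Hf.
  apply Hno; exists x, y, lam.
  destruct (f x) as [fx|]; [|destruct Hf; destruct (f (lam *' x +' (1 - lam) *' y)); exact I].
  destruct (f y) as [fy|]; [|destruct Hf; destruct (f (lam *' x +' (1 - lam) *' y)); exact I].
  exists fx, fy; split; [auto|split; [auto|split; [auto|]]].
  destruct (f (lam *' x +' (1 - lam) *' y)) as [r|]; simpl in *; [|auto].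
  pose proof (Rmax_l fx fy); pose proof (Rmax_r fx fy); lra.
Qed.

(* Two applications of the mean value theorem: the first subgradient [xi] at [u] points towards
   [y]; the second one, [eta] at [w], is taken on a segment issued from [y] aiming at [u], so
   that [xi (w - u) > 0] and [eta (u - w) > 0].  One of the two contradicts (b). *)
Lemma quasiconvex_of_condition_b (phi : X -> ER) alpha : 0 < alpha ->
  Asplund X -> lsc phi -> condition_b alpha phi -> quasiconvex phi.
Proof.
  intros Ha HX Hlsc Hb; apply NNPP; intros Hn.
  destruct (not_quasiconvex _ Hn) as (x & y & lam & fx & fy & Hlam & Hfx & Hfy & Hzx & Hzy).
  set (z := lam *' x +' (1 - lam) *' y) in *.
  assert (Hb0 : forall u w fu fw xi, frechet_at phi u fu xi -> bounded_form xi ->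
            phi w = Fin fw -> fw <= fu -> xi (w -' u) <= 0).
  { intros u w fu fw xi Hat Hxi Hw Hle.
    pose proof (Hb u w fu fw (proj1 (proj2 Hat)) Hw Hle _ (frechet_subdiff_of_at _ _ _ _ Hat Hxi)).
    assert (0 <= Rmin (alpha * vnorm (w -' u)) (fu - fw)); [|lra].
    pose proof (vnorm_nonneg (w -' u)); apply Rmin_glb; nra. }
  destruct (Hlsc z _ Hzy) as (del & Hdel & Hball).
  destruct (mean_value phi x z fx (/ (1 - lam)) del HX Hlsc Hfx Hzx)
    as (u & fu & xi & t & Ht & Hu & Hat & Hxib & Hpos); auto.
  { rewrite <- Rinv_1; apply Rinv_lt_contravar; lra. }
  replace (seg x z (/ (1 - lam))) with y in Hpos by (unfold seg, z; vec; field; lra).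
  set (q := 1 - t * (1 - lam)).
  assert (Hq : 0 < q) by (unfold q; nra).
  (* The parameter of [z] on the segment from [seg x z t] to [y]. The same parameter on the segment
     from [u] to [y] gives [z'], whose distance to [z] is at most that of [u] to [seg x z t]. *)
  set (sig := (1 - t) * (1 - lam) / q).
  assert (Hsigq : sig * q = (1 - t) * (1 - lam)) by (unfold sig; field; lra).
  assert (Hsig0 : 0 < sig) by (apply Rdiv_lt_0_compat; nra).
  assert (Hsig1 : sig < 1).
  { apply Rmult_lt_reg_r with q; auto; rewrite Hsigq; unfold q; lra. }
  set (z' := u +' sig *' (y -' u)).
  assert (Hz' : vnorm (z' -' z) < del).
  { replace (z' -' z) with ((1 - sig) *' (u -' seg x z t)).
    - rewrite vnorm_scal_nonneg by lra; pose proof (vnorm_nonneg (u -' seg x z t)); nra.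
    - unfold z', z, seg; vec; unfold q in Hsigq; lra. }
  destruct Hxib as (K & HK & HKb).
  (* Before perturbation [xi (w -' u)] is at least [sig * xi (y -' u)]; this [eps] costs at most
     half of it. *)
  set (eps := sig * xi (y -' u) / (2 * (K + 1))).
  assert (Hsx : 0 < sig * xi (y -' u)) by nra.
  assert (Heps : 0 < eps) by (apply Rdiv_lt_0_compat; lra).
  destruct (mean_value phi y z' fy (/ (1 - sig)) eps HX Hlsc Hfy)
    as (w & fw & eta & s & Hs & Hw & Hat' & Hetab & Hpos'); auto.
  { rewrite <- Rinv_1; apply Rinv_lt_contravar; lra. }
  replace (seg y z' (/ (1 - sig))) with u in Hpos' by (unfold seg, z'; vec; field; lra).
  assert (Hxw : 0 < xi (w -' u)).
  { destruct Hat as (Hxi & _).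
    replace (w -' u) with ((w -' seg y z' s) +' (1 - s * (1 - sig)) *' (y -' u))
      by (unfold seg, z'; vec).
    rewrite (proj1 Hxi), (proj2 Hxi).
    pose proof (bounded_by_le _ _ (w -' seg y z' s) HKb) as H1.
    assert (H2 : K * vnorm (w -' seg y z' s) <= sig * xi (y -' u) / 2).
    { apply Rle_trans with ((K + 1) * eps).
      - pose proof (vnorm_nonneg (w -' seg y z' s)); apply Rmult_le_compat; lra.
      - right; unfold eps; field; lra. }
    assert (sig * xi (y -' u) <= (1 - s * (1 - sig)) * xi (y -' u)); [|lra].
    apply Rmult_le_compat_r; [lra|nra]. }
  destruct (Rle_dec fw fu) as [Hle|Hle].
  - pose proof (Hb0 u w fu fw xi Hat (ex_intro _ K (conj HK HKb)) (proj1 (proj2 Hat')) Hle); lra.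
  - pose proof (Hb0 w u fw fu eta Hat' Hetab (proj1 (proj2 Hat)) ltac:(lra)); lra.
Qed.

Lemma quasiconvex_seg (phi : X -> ER) x y fx fy s : quasiconvex phi ->
  phi x = Fin fx -> phi y = Fin fy -> 0 <= s <= 1 ->
  exists r, phi (seg x y s) = Fin r /\ r <= Rmax fx fy.
Proof.
  intros Hq Hx Hy [[H0|H0] [H1|H1]].
  - pose proof (Hq x y (1 - s) ltac:(lra)) as H.
    replace ((1 - s) *' x +' (1 - (1 - s)) *' y) with (seg x y s) in H by (unfold seg; vec).
    rewrite Hx, Hy in H; destruct (phi (seg x y s)) as [r|]; simpl in H; [eauto|contradiction].
  - subst s; exists fy; split; [|apply Rmax_r].
    replace (seg x y 1) with y by (unfold seg; vec); auto.
  - subst s; exists fx; split; [|apply Rmax_l].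
    replace (seg x y 0) with x by (unfold seg; vec); auto.
  - lra.
Qed.

(* Since [phi] is quasiconvex and larger at [z] than at [x], it is nondecreasing on [z, y], so
   along [z, y] the tilted function cannot jump below the level [r] but must cross it. *)
Lemma tilt_segment_crossing (phi : X -> ER) (v : X -> R) x y fx fz c0 r :
  quasiconvex phi -> lsc (tilt phi v) -> linear_form v -> v (y -' x) <= 0 ->
  in_dom phi y -> phi x = Fin fx -> 0 < c0 < 1 -> phi (seg x y c0) = Fin fz -> fx < fz ->
  r < fz + v (seg x y c0) -> (forall fy, phi y = Fin fy -> fy + v y < r) ->
  exists c1, c0 < c1 <= 1 /\ tilt phi v (seg x y c1) = Fin r /\
    forall c, c0 <= c <= c1 -> exists s, phi (seg x y c) = Fin s /\ fz <= s /\
      r <= s + v (seg x y c).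
Proof.
  intros Hq Hlsc Hv Hvyx [fy Hfy] Hfx Hc0 Hfz Hlt Hr Hyr; specialize (Hyr fy Hfy).
  set (F := fun c => ER_val (phi (seg x y c))).
  assert (HF : forall c, 0 <= c <= 1 -> phi (seg x y c) = Fin (F c)).
  { intros c Hc; destruct (quasiconvex_seg phi x y fx fy c Hq Hfx Hfy Hc) as (s & Hs & _).
    unfold F; rewrite Hs; reflexivity. }
  assert (Hsub : forall c c', 0 <= c <= c' -> 0 < c' <= 1 -> F c <= Rmax fx (F c')).
  { intros c c' Hc Hc'.
    destruct (quasiconvex_seg phi x (seg x y c') fx (F c') (c / c') Hq Hfx) as (s & Hs & Hle).
    - apply HF; lra.
    - split; [apply Rmult_le_pos; [lra|apply Rlt_le, Rinv_0_lt_compat; lra]|].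
      apply Rmult_le_reg_r with c'; [lra|].
      replace (c / c' * c') with c by (field; lra); lra.
    - replace (seg x (seg x y c') (c / c')) with (seg x y c) in Hs by (unfold seg; vec; field; lra).
      unfold F at 1; rewrite Hs; exact Hle. }
  assert (HF0 : F c0 = fz) by (unfold F; rewrite Hfz; reflexivity).
  assert (HFge : forall c, c0 <= c <= 1 -> fz <= F c).
  { intros c Hc; pose proof (Hsub c0 c ltac:(lra) ltac:(lra)) as H; rewrite HF0 in H.
    revert H; unfold Rmax; destruct Rle_dec; lra. }
  assert (HFmono : forall c c', c0 <= c <= c' -> c' <= 1 -> F c <= F c').
  { intros c c' Hc Hc'; pose proof (Hsub c c' ltac:(lra) ltac:(lra)) as H.
    pose proof (HFge c ltac:(lra)); revert H; unfold Rmax; destruct Rle_dec; lra. }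
  assert (Hvseg : forall c, v (seg x y c) = v x + c * v (y -' x)).
  { intros c; unfold seg; rewrite (proj1 Hv), (proj2 Hv); reflexivity. }
  set (G := fun c => F c + v (seg x y c)).
  assert (HG0 : r < G c0) by (unfold G; rewrite HF0; lra).
  assert (HG1 : G 1 < r).
  { unfold G, F; replace (seg x y 1) with y by (unfold seg; vec); rewrite Hfy; simpl; lra. }
  set (E := fun c => c0 <= c <= 1 /\ forall s, c0 <= s <= c -> r <= G s).
  assert (HE0 : E c0).
  { split; [lra|]; intros s Hs; replace s with c0 by lra; lra. }
  destruct (completeness E) as [c1 [Hub Hlub]].
  { exists 1; intros c [Hc _]; lra. }
  { exists c0; auto. }
  assert (Hc01 : c0 <= c1) by (apply Hub; auto).
  assert (Hc11 : c1 <= 1) by (apply Hlub; intros c [Hc _]; lra).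
  assert (Hbelow : forall s, c0 <= s < c1 -> r <= G s).
  { intros s Hs; apply NNPP; intros Hns.
    assert (c1 <= s); [|lra]; apply Hlub; intros c [Hc Hall].
    apply Rnot_lt_le; intros Hsc; apply Hns, Hall; lra. }
  (* [F] is nondecreasing and the linear part has slope [V <= 0], so [G] loses at most
     [(c1 - s) * - V] from [s] to [c1]. The denominator [1 - V] is positive even when [V = 0]. *)
  assert (HGc1 : r <= G c1).
  { destruct (Req_dec c0 c1) as [<-|Hne]; [lra|].
    apply le_epsilon; intros eps He; set (V := v (y -' x)) in *.
    set (s := Rmax c0 (c1 - eps / (1 - V))).
    assert (HeV : 0 < eps / (1 - V)) by (apply Rdiv_lt_0_compat; lra).
    assert (Hs : c0 <= s < c1) by (split; [apply Rmax_l|apply Rmax_lub_lt; lra]).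
    assert (Hs2 : c1 - s <= eps / (1 - V)) by (unfold s; pose proof (Rmax_r c0 (c1 - eps / (1 - V))); lra).
    pose proof (Hbelow s Hs) as H; pose proof (HFmono s c1 ltac:(lra) Hc11).
    unfold G in *; rewrite Hvseg in *; fold V in H |- *.
    assert ((c1 - s) * - V <= eps); [|lra].
    apply Rle_trans with (eps / (1 - V) * (1 - V)); [apply Rmult_le_compat; lra|].
    right; field; lra. }
  (* A strict excess over [r] would persist slightly beyond [c1] by lower semicontinuity, against
     the choice of [c1] as a supremum. *)
  assert (HGc1' : G c1 <= r).
  { apply Rnot_lt_le; intros Hgt.
    assert (Hc1 : c1 < 1) by (destruct Hc11 as [H|H]; auto; rewrite H in *; lra).
    destruct (Hlsc (seg x y c1) r) as (del & Hdel & Hball).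
    { unfold tilt; rewrite HF by lra; exact Hgt. }
    pose proof (vnorm_nonneg (y -' x)) as Hn.
    set (k := del / (2 * (vnorm (y -' x) + 1))).
    assert (Hk : 0 < k) by (apply Rdiv_lt_0_compat; lra).
    set (c2 := Rmin 1 (c1 + k)).
    assert (Hc2 : c1 < c2) by (apply Rmin_glb_lt; lra).
    assert (HE2 : E c2).
    { split; [split; [lra|apply Rmin_l]|]; intros s Hs.
      destruct (Rlt_dec s c1) as [H|H]; [apply Hbelow; lra|].
      assert (Hs2 : s <= c1 + k) by (eapply Rle_trans; [apply Hs|apply Rmin_r]).
      assert (Hs1 : s <= 1) by (eapply Rle_trans; [apply Hs|apply Rmin_l]).
      specialize (Hball (seg x y s)); rewrite vnorm_seg_sub, Rabs_pos_eq in Hball by lra.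
      assert (Hlt2 : (s - c1) * vnorm (y -' x) < del).
      { apply Rle_lt_trans with (k * (vnorm (y -' x) + 1)); [apply Rmult_le_compat; lra|].
        unfold k; replace (del / (2 * (vnorm (y -' x) + 1)) * (vnorm (y -' x) + 1))
          with (del / 2) by (field; lra); lra. }
      specialize (Hball Hlt2); unfold tilt in Hball; rewrite HF in Hball by lra.
      simpl in Hball; unfold G; lra. }
    pose proof (Hub c2 HE2); lra. }
  exists c1; split; [split; [|auto]|split].
  - destruct Hc01 as [H|H]; [auto|rewrite <- H in *; lra].
  - unfold tilt; rewrite HF by lra; simpl; f_equal; unfold G in *; lra.
  - intros c Hc; exists (F c); split; [apply HF; lra|split; [apply HFge; lra|]].
    destruct (proj2 Hc) as [H|H]; [apply Hbelow; lra|rewrite H; auto].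
Qed.

(** On the whole segment from the crossing point [y'] to [z], both [phi] and its tilt exceed their
    values at [x]; so they do at a nearby [w]. The mean value theorem, aimed at [x], gives a
    subgradient positive on [x -' w], which [condition_b_tilt] excludes. *)
Lemma tilt_no_violation (phi : X -> ER) alpha (v : X -> R) x y lam px py : 0 < alpha ->
  Asplund X -> lsc phi -> condition_b alpha phi ->
  linear_form v -> bounded_by alpha v -> 0 < lam < 1 -> v y <= v x ->
  tilt phi v x = Fin px -> tilt phi v y = Fin py ->
  R_lt_ER px (tilt phi v (lam *' x +' (1 - lam) *' y)) ->
  R_lt_ER py (tilt phi v (lam *' x +' (1 - lam) *' y)) -> False.
Proof.
  intros Ha HX Hlsc Hb Hv Hva Hlam Hvyx Hpx Hpy Hzx Hzy.
  assert (Hvb : bounded_form v) by (exists alpha; split; [lra|auto]).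
  pose proof (quasiconvex_of_condition_b phi alpha Ha HX Hlsc Hb) as Hq.
  pose proof (lsc_tilt phi v Hlsc Hv Hvb) as Hlsct.
  replace (lam *' x +' (1 - lam) *' y) with (seg x y (1 - lam)) in * by (unfold seg; vec).
  set (c0 := 1 - lam) in *; assert (Hc0 : 0 < c0 < 1) by (unfold c0; lra).
  unfold tilt in Hpx, Hpy; destruct (phi x) as [fx|] eqn:Hfx; simpl in Hpx; [|discriminate].
  destruct (phi y) as [fy|] eqn:Hfy; simpl in Hpy; [|discriminate].
  injection Hpx as <-; injection Hpy as <-.
  destruct (quasiconvex_seg phi x y fx fy c0 Hq Hfx Hfy) as (fz & Hfz & _); [lra|].
  unfold tilt in Hzx, Hzy; rewrite Hfz in Hzx, Hzy; simpl in Hzx, Hzy.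
  set (z := seg x y c0) in *.
  assert (Hvd : v (y -' x) <= 0) by (rewrite (linear_sub v) by auto; lra).
  assert (Hvz : v z <= v x).
  { unfold z, seg; rewrite (proj1 Hv), (proj2 Hv); nra. }
  set (r := (Rmax (fx + v x) (fy + v y) + (fz + v z)) / 2).
  assert (Hr : fx + v x < r /\ fy + v y < r /\ r < fz + v z).
  { unfold r, Rmax; destruct Rle_dec; lra. }
  destruct (tilt_segment_crossing phi v x y fx fz c0 r) as (c1 & Hc1 & Hpc1 & Hseg); auto.
  { exists fy; auto. }
  { lra. }
  { apply Hr. }
  { intros fy' H; rewrite Hfy in H; injection H as <-; apply Hr. }
  set (y' := seg x y c1).
  assert (Hsegs : forall t, 0 <= t <= 1 -> exists s, phi (seg y' z t) = Fin s /\ fz <= s /\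
            r <= s + v (seg y' z t)).
  { intros t Ht; replace (seg y' z t) with (seg x y (c1 - t * (c1 - c0)))
      by (unfold y', z, seg; vec); apply Hseg; nra. }
  destruct (lsc_segment_tube (tilt phi v) y' z (fun _ => fx + v x) Hlsct)
    as (_ & d1 & Hd1 & Htube1).
  { intros; lra. }
  { intros t Ht; exists O; destruct (Hsegs t Ht) as (s & Hs & _ & Hs').
    unfold tilt; rewrite Hs; simpl; lra. }
  destruct (lsc_segment_tube phi y' z (fun _ => fx) Hlsc) as (_ & d2 & Hd2 & Htube2).
  { intros; lra. }
  { intros t Ht; exists O; destruct (Hsegs t Ht) as (s & Hs & Hs' & _).
    rewrite Hs; simpl; lra. }
  (* This parameter is the one at which the ray from [y'] through [z] reaches [x]. *)
  destruct (mean_value (tilt phi v) y' z r (c1 / (c1 - c0)) (Rmin d1 d2) HX Hlsct Hpc1)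
    as (w & pw & eta & t & Ht & Hw & Hat & Hetab & Hpos).
  { unfold tilt; rewrite Hfz; simpl; lra. }
  { apply Rmult_lt_reg_r with (c1 - c0); [lra|].
    replace (c1 / (c1 - c0) * (c1 - c0)) with c1 by (field; lra); lra. }
  { apply Rmin_pos; auto. }
  replace (seg y' z (c1 / (c1 - c0))) with x in Hpos by (unfold y', z, seg; vec; field; lra).
  pose proof (Htube1 t w ltac:(lra) (Rlt_le_trans _ _ _ Hw (Rmin_l _ _))) as H1.
  pose proof (Htube2 t w ltac:(lra) (Rlt_le_trans _ _ _ Hw (Rmin_r _ _))) as H2.
  pose proof (proj1 (proj2 Hat)) as Hpw; rewrite Hpw in H1; simpl in H1.
  unfold tilt in Hpw; destruct (phi w) as [fw|] eqn:Hfw; simpl in Hpw, H2; [|discriminate].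
  injection Hpw as <-.
  pose proof (condition_b_tilt phi alpha v w x fw fx eta Hb Hv Hva Hat Hetab Hvb Hfx); lra.
Qed.

End RobustQuasiconvexity.

Theorem theorem3p1 (X : NormedSpace) (HX : Banach X) (phi : X -> ER)
  (Hproper : proper phi) (Hlsc : lsc phi) (alpha : R) (Halpha : 0 < alpha) :
  (robustly_quasiconvex alpha phi -> condition_b alpha phi) /\
  (Asplund X -> condition_b alpha phi -> robustly_quasiconvex alpha phi).
Proof.
  split; [apply condition_b_of_robust; auto|].
  intros HA Hb v Hv Hva; apply is_dual_iff in Hv; destruct Hv as [Hv _].
  apply NNPP; intros Hn.
  destruct (not_quasiconvex _ Hn) as (x & y & lam & px & py & Hlam & Hpx & Hpy & Hzx & Hzy).
  destruct (Rle_dec (v y) (v x)) as [Hle|Hle].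
  - apply (tilt_no_violation phi alpha v x y lam px py); auto.
  (* When [v] increases from [x] to [y], the segment is traversed in the opposite direction. *)
  - replace (lam *' x +' (1 - lam) *' y) with ((1 - lam) *' y +' (1 - (1 - lam)) *' x) in * by vec.
    apply (tilt_no_violation phi alpha v y x (1 - lam) py px); auto; lra.
Qed.
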